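(* Let $\alpha\in(0,1]$ and $\beta\in[0,1)$, and let $f(z)=z+\sum_{k=2}^\infty a_k z^k\in\mathcal{G}(\alpha)$. Then for all $n\ge 2$ the section $s_n(z;f)$ is close-to-convex of order $\beta$ in the disk $|z|<\rho_{\mathcal{C}}$, where $\rho_{\mathcal{C}}$ is the least positive root in $[0,1)$ of the equation $K_{\alpha,\beta}(\rho)=0$, with $$K_{\alpha,\beta}(\rho)=(1-\rho)^{\alpha}+\alpha\bigl(\ln(1-\rho)+\rho\bigr)-\beta.$$
   Context: Let $\mathbb{D}=\{z\in\mathbb{C}:|z|<1\}$ and let $\mathcal{A}$ be the family of analytic functions $f$ in $\mathbb{D}$ with $f(0)=0$ and $f'(0)=1$, i.e. $f(z)=z+\sum_{k=2}^\infty a_kz^k$. For $\alpha>0$, $\mathcal{G}(\alpha)$ is the class of locally univalent $f\in\mathcal{A}$ (so $f'(z)\ne0$ in $\mathbb{D}$) satisfying $\Re\left(1+\frac{zf''(z)}{f'(z)}\right)<1+\frac{\alpha}{2}$ for all $z\in\mathbb{D}$. The $n$-th section (partial sum) of $f$ is the polynomial $s_n(z;f)=z+\sum_{k=2}^n a_kz^k$. For $0\le\beta<1$, a function $g$ (normalized by $g(0)=0$, $g'(0)=1$) is close-to-convex of order $\beta$ in the disk $|z|<r$ if there exist $\theta\in\mathbb{R}$ and a function $\psi$, analytic in $|z|<r$ with $\psi(0)=0$, $\psi'(0)=1$ and convex there (i.e. $\psi'(z)\ne0$ and $\Re(1+z\psi''(z)/\psi'(z))>0$ for $|z|<r$), such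 that $\Re\left(e^{i\theta}\frac{g'(z)}{\psi'(z)}\right)>\beta$ for all $|z|<r$. *)

(* Defs.v *)
From Stdlib Require Import Reals.
From Coquelicot Require Import Coquelicot.
Open Scope R_scope.

(* Functions live on all of [C], but only their values on the disk matter:
   differentiability and [C_derive] at a point of the open disk are local. *)
Definition analytic_in_disk (f : C -> C) (r : R) : Prop :=
  forall z : C, Cmod z < r -> @ex_derive C_AbsRing C_NormedModule f z.

Definition normalized (f : C -> C) : Prop :=
  f (RtoC 0) = RtoC 0 /\ C_derive f (RtoC 0) = RtoC 1.

Definition class_A (f : C -> C) : Prop :=
  analytic_in_disk f 1 /\ normalized f.

(* 1 + z f''(z) / f'(z) *)
Definition curvature (f : C -> C) (z : C) : C :=
  (1 + z * C_derive (C_derive f) z / C_derive f z)%C.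

Definition class_G (alpha : R) (f : C -> C) : Prop :=
  class_A f /\
  (forall z : C, Cmod z < 1 -> C_derive f z <> RtoC 0) /\
  (forall z : C, Cmod z < 1 -> Re (curvature f z) < 1 + alpha / 2).

(* s_n(z) = z + sum_{k=2}^n a_k z^k; [a 0] and [a 1] are not used. *)
Definition partial_section (a : nat -> C) (n : nat) (z : C) : C :=
  (z + sum_n_m (fun k => a k * z ^ k) 2 n)%C.

Definition convex_in_disk (psi : C -> C) (r : R) : Prop :=
  analytic_in_disk psi r /\ normalized psi /\
  (forall z : C, Cmod z < r -> C_derive psi z <> RtoC 0) /\
  (forall z : C, Cmod z < r -> 0 < Re (curvature psi z)).

Definition expi (theta : R) : C := (cos theta, sin theta).

Definition close_to_convex_in_disk (beta : R) (g : C -> C) (r : R) : Prop :=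
  analytic_in_disk g r /\ normalized g /\
  exists (theta : R) (psi : C -> C),
    convex_in_disk psi r /\
    forall z : C, Cmod z < r ->
      beta < Re (expi theta * (C_derive g z / C_derive psi z))%C.

(* [Rpower x y] is the real power x^y only for x > 0, so [K] is meant for
   rho < 1. *)
Definition K (alpha beta rho : R) : R :=
  Rpower (1 - rho) alpha + alpha * (ln (1 - rho) + rho) - beta.

Definition is_least_positive_root (F : R -> R) (rho : R) : Prop :=
  0 < rho < 1 /\ F rho = 0 /\
  forall x : R, 0 < x < 1 -> F x = 0 -> rho <= x.

(* Main.v *)
Require Import Defs.
From Stdlib Require Import Reals Ranalysis5 Lra Lia.
From Coquelicot Require Import Coquelicot.
Open Scope R_scope.

(** Take the identity for [psi] and [theta = 0]: it suffices that the derivative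
    of the section has real part larger than [beta] on |z| < rho.  Write
    g = f' = sum b_k z^k, so that b_0 = 1 and the derivative of the n-th section
    is the truncation of g at degree n - 1.  Two facts about g are needed:
    |b_k| <= alpha / k for k >= 1 ([coefficient_bound]), and
    Re g(z) >= (1 - |z|)^alpha ([distortion]).  With r = |z|, the first bounds
    the tail of g beyond the truncation by alpha times the sum of r^k / k over
    k >= 2, that is by - alpha (ln (1 - r) + r), so the truncation has real part
    at least K(r) + beta.  Since K decreases from K(0) = 1 - beta > 0 to negative
    values, it is positive before its first root ([K_root]).

    Both facts rest on one remark.  The condition Re (z g' / g) < alpha / 2 says
    that z g' is closer to 0 than to alpha g, so z g' = omega (z g' - alpha g)
    with omega analytic, omega(0) = 0 and |omega| <= 1.

    The coefficient bound is Clunie's method.  Multiplication by omega raises the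
    order of vanishing at 0 and does not increase mean squares over circles, so
    truncating both sides gives
    sum_(k <= n) |k b_k|^2 r^(2k) <= sum_(k < n) |(k - alpha) b_k|^2 r^(2k)
    ([clunie_truncation]).  As |k - alpha| <= k for k >= 1, only
    |n b_n|^2 r^(2n) <= alpha^2 is left, and r tends to 1.

    For the distortion bound, the Schwarz lemma gives |omega(z)| <= |z|, which
    confines g' / g to a disk at every point.  Integrating along a radius puts
    log g(z) in the disk of centre (alpha/2) ln (1 - r^2) and radius
    a = (alpha/2) ln ((1 + r) / (1 - r)), whose leftmost point is
    alpha ln (1 - r).  On a disk of radius at most 1 the real part of exp is
    smallest at the leftmost point ([exp_disk_Re_ge]), and a <= 1 wherever K is
    positive ([K_pos_log_disk_radius]).  That last fact replaces the
    subordination of g to (1 - z)^alpha, which would give the bound for all r.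

    The function theory behind this is the mean value property of C^1
    complex-differentiable functions ([mean_value]), proved by differentiating
    circular means in the radius, and termwise differentiation of power series
    ([csum_cdiff]). *)

(** * Complex derivatives and continuously differentiable functions on the unit disk *)

(** Stated for the topology of the absolute value on the target, where the
    product and chain rules apply; [is_derive_cdiff] passes to the product
    topology. *)
Definition cdiff (F : C -> C) (z d : C) : Prop :=
  @is_derive C_AbsRing (AbsRing_NormedModule C_AbsRing) F z d.

Definition ccont (F : C -> C) (z : C) : Prop :=
  @continuous (AbsRing_UniformSpace C_AbsRing) (AbsRing_UniformSpace C_AbsRing) F z.

Lemma cdiffE (F : C -> C) (z d : C) :
  cdiff F z d <->
  forall eps : R, 0 < eps -> exists delta : R, 0 < delta /\
    forall w : C, Cmod (w - z) < delta ->
      Cmod (F w - F z - d * (w - z)) <= eps * Cmod (w - z).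
Proof.
assert (E : forall w, minus (minus (F w) (F z)) (scal (minus w z) d : C_AbsRing)
                      = (F w - F z - d * (w - z))%C).
{ intros w. unfold minus, scal, plus, opp, mult; simpl.
  unfold mult; simpl. ring. }
split.
- intros [_ H] eps Heps.
  destruct (H z (fun P HP => HP) (mkposreal eps Heps)) as [delta Hd].
  exists delta; split; [apply cond_pos|].
  intros w Hw. rewrite <- E. exact (Hd w Hw).
- intros H; split.
  + apply is_linear_scal_l.
  + intros x Hx.
    assert (Hz : z = x)
      by exact (@is_filter_lim_locally_unique C_AbsRing
                  (AbsRing_NormedModule C_AbsRing) z x Hx).
    subst x. intros eps. destruct (H eps (cond_pos eps)) as [delta [Hd Hb]].
    exists (mkposreal delta Hd). intros w Hw.
    specialize (Hb w Hw). rewrite <- E in Hb. exact Hb.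
Qed.

Lemma is_derive_cdiff (F : C -> C) (z d : C) :
  @is_derive C_AbsRing C_NormedModule F z d <-> cdiff F z d.
Proof.
split; intros [_ H]; (split; [apply is_linear_scal_l | exact H]).
Qed.

Lemma C_derive_cdiff (F : C -> C) (z d : C) : cdiff F z d -> C_derive F z = d.
Proof. intros H. apply is_C_derive_unique, is_derive_cdiff, H. Qed.

Lemma ccontE (F : C -> C) (z : C) :
  ccont F z <->
  forall eps : R, 0 < eps -> exists delta : R, 0 < delta /\
    forall w : C, Cmod (w - z) < delta -> Cmod (F w - F z) < eps.
Proof.
split.
- intros H eps Heps.
  destruct (H (fun y => Cmod (y - F z) < eps)) as [delta Hd].
  + exists (mkposreal eps Heps). intros y Hy; exact Hy.
  + exists delta; split; [apply cond_pos | exact Hd].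
- intros H P [eps HP]. destruct (H eps (cond_pos eps)) as [delta [Hd Hb]].
  exists (mkposreal delta Hd). intros w Hw. apply HP, Hb, Hw.
Qed.

Lemma cdiff_ccont (F : C -> C) (z d : C) : cdiff F z d -> ccont F z.
Proof.
intros H.
apply (@ex_derive_continuous C_AbsRing (AbsRing_NormedModule C_AbsRing)).
exists d; exact H.
Qed.

Lemma cdiff_const (c z : C) : cdiff (fun _ => c) z 0.
Proof. exact (@is_derive_const C_AbsRing (AbsRing_NormedModule C_AbsRing) c z). Qed.

Lemma cdiff_id (z : C) : cdiff (fun w => w) z 1.
Proof. exact (@is_derive_id C_AbsRing z). Qed.

Lemma cdiff_plus (F G : C -> C) (z dF dG : C) :
  cdiff F z dF -> cdiff G z dG -> cdiff (fun w => F w + G w)%C z (dF + dG)%C.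
Proof.
exact (@is_derive_plus C_AbsRing (AbsRing_NormedModule C_AbsRing) F G z dF dG).
Qed.

Lemma cdiff_mult (F G : C -> C) (z dF dG : C) :
  cdiff F z dF -> cdiff G z dG ->
  cdiff (fun w => F w * G w)%C z (dF * G z + F z * dG)%C.
Proof.
intros HF HG. exact (@is_derive_mult C_AbsRing F G z dF dG HF HG Cmult_comm).
Qed.

Lemma cdiff_comp (F G : C -> C) (z dF dG : C) :
  cdiff F (G z) dF -> cdiff G z dG -> cdiff (fun w => F (G w)) z (dG * dF)%C.
Proof.
exact (@is_derive_comp C_AbsRing (AbsRing_NormedModule C_AbsRing) F G z dF dG).
Qed.

Lemma cdiff_ext_disk (F G : C -> C) (z d : C) (r : R) :
  (forall w, Cmod w < r -> F w = G w) -> Cmod z < r -> cdiff F z d -> cdiff G z d.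
Proof.
intros HE Hz HF.
refine (@is_derive_ext_loc C_AbsRing (AbsRing_NormedModule C_AbsRing) F G z d _ HF).
assert (Hp : 0 < r - Cmod z) by lra.
exists (mkposreal _ Hp). intros w Hw. apply HE.
change (Cmod (w - z) < r - Cmod z) in Hw.
replace w with ((w - z) + z)%C by ring.
pose proof (Cmod_triangle (w - z) z). lra.
Qed.

Lemma cdiff_inv (z : C) : z <> 0 -> cdiff Cinv z (- (/ z * / z))%C.
Proof.
intros Hz. apply cdiffE. intros eps Heps.
assert (Hm : 0 < Cmod z) by (apply Cmod_gt_0; exact Hz).
(* |w| > |z| / 2 bounds the denominator of (w - z)^2 / (w z^2). *)
exists (Rmin (Cmod z / 2) (eps * (Cmod z * Cmod z * Cmod z) / 2)).
split.
{ apply Rmin_pos; [lra|]. apply Rdiv_lt_0_compat; [|lra].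
  repeat apply Rmult_lt_0_compat; lra. }
intros w Hw.
assert (H1 := Rlt_le_trans _ _ _ Hw (Rmin_l _ _)).
assert (H2 := Rlt_le_trans _ _ _ Hw (Rmin_r _ _)).
assert (Hwm : Cmod z / 2 < Cmod w).
{ pose proof (Cmod_triangle (z - w) w) as H.
  replace (z - w + w)%C with z in H by ring.
  replace (Cmod (z - w)) with (Cmod (w - z)) in H.
  - lra.
  - rewrite <- Cmod_opp. f_equal. ring. }
assert (Hw0 : w <> 0) by (apply Cmod_gt_0; lra).
replace (/ w - / z - - (/ z * / z) * (w - z))%C
  with (((w - z) * (w - z)) / (w * (z * z)))%C by (field; split; assumption).
rewrite Cmod_div, !Cmod_mult by (repeat apply Cmult_neq_0; assumption).
apply Rmult_le_reg_r with (Cmod w * (Cmod z * Cmod z)).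
{ repeat apply Rmult_lt_0_compat; lra. }
unfold Rdiv. rewrite Rmult_assoc, Rinv_l, Rmult_1_r.
2:{ apply Rgt_not_eq. repeat apply Rmult_lt_0_compat; lra. }
pose proof (Cmod_ge_0 (w - z)).
replace (eps * Cmod (w - z) * (Cmod w * (Cmod z * Cmod z)))
  with (Cmod (w - z) * (eps * (Cmod w * (Cmod z * Cmod z)))) by ring.
apply Rmult_le_compat_l; [assumption|].
apply Rle_trans with (1 := Rlt_le _ _ H2).
replace (eps * (Cmod z * Cmod z * Cmod z) / 2)
  with (eps * (Cmod z / 2 * (Cmod z * Cmod z))) by field.
apply Rmult_le_compat_l; [lra|].
apply Rmult_le_compat_r; [apply Rle_0_sqr|lra].
Qed.

Lemma ccont_plus (F G : C -> C) z :
  ccont F z -> ccont G z -> ccont (fun w => F w + G w)%C z.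
Proof.
exact (@continuous_plus (AbsRing_UniformSpace C_AbsRing) C_AbsRing
  (AbsRing_NormedModule C_AbsRing) F G z).
Qed.

Lemma ccont_mult (F G : C -> C) z :
  ccont F z -> ccont G z -> ccont (fun w => F w * G w)%C z.
Proof. exact (@continuous_mult (AbsRing_UniformSpace C_AbsRing) C_AbsRing F G z). Qed.

Lemma ccont_comp (F G : C -> C) z :
  ccont G z -> ccont F (G z) -> ccont (fun w => F (G w)) z.
Proof.
exact (@continuous_comp (AbsRing_UniformSpace C_AbsRing)
  (AbsRing_UniformSpace C_AbsRing) (AbsRing_UniformSpace C_AbsRing) G F z).
Qed.

Lemma ccont_const c z : ccont (fun _ => c) z.
Proof.
exact (@continuous_const (AbsRing_UniformSpace C_AbsRing)
  (AbsRing_UniformSpace C_AbsRing) c z).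
Qed.

Lemma ccont_ext (F G : C -> C) z :
  (forall w, F w = G w) -> ccont F z -> ccont G z.
Proof.
exact (@continuous_ext (AbsRing_UniformSpace C_AbsRing)
  (AbsRing_UniformSpace C_AbsRing) F G z).
Qed.

(** C^1 in the complex sense.  Continuity of the derivative is what allows
    differentiation under the integral sign, and it is inherited by products,
    compositions and inverses. *)
Definition holo (F : C -> C) : Prop :=
  exists dF : C -> C, forall z, Cmod z < 1 -> cdiff F z (dF z) /\ ccont dF z.

Lemma holo_const c : holo (fun _ => c).
Proof.
exists (fun _ => RtoC 0). intros z _; split; [apply cdiff_const | apply ccont_const].
Qed.

Lemma holo_id : holo (fun z => z).
Proof.
exists (fun _ => RtoC 1). intros z _; split; [apply cdiff_id | apply ccont_const].
Qed.

Lemma holo_plus F G : holo F -> holo G -> holo (fun z => F z + G z)%C.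
Proof.
intros [dF HF] [dG HG]. exists (fun z => dF z + dG z)%C.
intros z Hz. destruct (HF z Hz), (HG z Hz). split.
- apply cdiff_plus; assumption.
- apply ccont_plus; assumption.
Qed.

Lemma holo_mult F G : holo F -> holo G -> holo (fun z => F z * G z)%C.
Proof.
intros [dF HF] [dG HG]. exists (fun z => dF z * G z + F z * dG z)%C.
intros z Hz. destruct (HF z Hz), (HG z Hz). split.
- apply cdiff_mult; assumption.
- apply ccont_plus; apply ccont_mult; try assumption; eapply cdiff_ccont; eassumption.
Qed.

Lemma holo_pow F n : holo F -> holo (fun z => F z ^ n)%C.
Proof.
intros HF. induction n as [|n IH]; simpl.
- apply holo_const.
- apply holo_mult; assumption.
Qed.

Lemma holo_comp F G :
  holo F -> holo G -> (forall z, Cmod z < 1 -> Cmod (G z) < 1) ->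
  holo (fun z => F (G z)).
Proof.
intros [dF HF] [dG HG] Hm. exists (fun z => dG z * dF (G z))%C.
intros z Hz. destruct (HG z Hz), (HF (G z) (Hm z Hz)). split.
- apply cdiff_comp; assumption.
- apply ccont_mult; [assumption|].
  apply ccont_comp; [eapply cdiff_ccont; eassumption | assumption].
Qed.

Lemma holo_inv F :
  holo F -> (forall z, Cmod z < 1 -> F z <> 0) -> holo (fun z => / F z)%C.
Proof.
intros [dF HF] Hn. exists (fun z => dF z * - (/ F z * / F z))%C.
intros z Hz. destruct (HF z Hz) as [H1 H2].
assert (Hd : cdiff (fun w => / F w)%C z (dF z * - (/ F z * / F z))%C).
{ apply cdiff_comp; [apply cdiff_inv, Hn, Hz | exact H1]. }
split; [exact Hd|].
apply ccont_mult; [exact H2|].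
assert (Hc := cdiff_ccont _ _ _ Hd).
apply ccont_ext with (fun w => ((- (1)) * (/ F w * / F w))%C).
{ intros w. ring. }
apply ccont_mult; [apply ccont_const | apply ccont_mult; exact Hc].
Qed.

(** * The mean value property *)

Definition polar (r t : R) : C := (r * cos t, r * sin t).

Lemma Cmod_polar r t : Cmod (polar r t) = Rabs r.
Proof.
unfold Cmod, polar; simpl.
rewrite <- (sqrt_Rsqr_abs r). f_equal. unfold Rsqr.
pose proof (sin2_cos2 t) as H. unfold Rsqr in H.
replace (r * r) with (r * r * (sin t * sin t + cos t * cos t)) by (rewrite H; ring).
ring.
Qed.

Lemma im_le_Cmod z : Rabs (Im z) <= Cmod z.
Proof.
apply Rle_trans with (2 := Rmax_Cmod z). apply Rmax_r.
Qed.

Lemma Cmod_le_2Rmax (a b : R) : Cmod (a, b) <= 2 * Rmax (Rabs a) (Rabs b).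
Proof.
apply Rle_trans with (1 := Cmod_2Rmax (a, b)). simpl.
apply Rmult_le_compat_r.
- apply Rle_trans with (2 := Rmax_l _ _). apply Rabs_pos.
- pose proof (sqrt_sqrt 2). pose proof (sqrt_pos 2). nra.
Qed.

Lemma Cmod_lt_Rmax (a b d : R) : Rabs a < d / 2 -> Rabs b < d / 2 -> Cmod (a, b) < d.
Proof.
intros Ha Hb. pose proof (Cmod_le_2Rmax a b).
assert (Rmax (Rabs a) (Rabs b) < d / 2) by (apply Rmax_lub_lt; assumption). lra.
Qed.

(** The Cauchy-Riemann equations. *)
Lemma cdiff_differentiable (F : C -> C) (x y : R) (d : C) :
  cdiff F (x, y) d ->
  differentiable_pt_lim (fun u v => Re (F (u, v))) x y (Re d) (- Im d) /\
  differentiable_pt_lim (fun u v => Im (F (u, v))) x y (Im d) (Re d).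
Proof.
intros H; rewrite cdiffE in H.
assert (Hc : forall eps : posreal, locally_2d (fun u v =>
  Cmod (F (u, v) - F (x, y) - d * ((u, v) - (x, y)))
    <= eps * Rmax (Rabs (u - x)) (Rabs (v - y))) x y).
{ intros eps. destruct (H (eps / 2)) as [delta [Hd Hb]].
  { pose proof (cond_pos eps). lra. }
  assert (Hd2 : 0 < delta / 2) by lra.
  exists (mkposreal _ Hd2). simpl. intros u v Hu Hv.
  apply Rle_trans with (1 := Hb (u, v) (Cmod_lt_Rmax (u - x) (v - y) _ Hu Hv)).
  pose proof (Cmod_le_2Rmax (u - x) (v - y)). pose proof (cond_pos eps).
  change ((u, v) - (x, y))%C with (u - x, v - y).
  nra. }
split; intros eps; destruct (Hc eps) as [delta Hd]; exists delta;
  intros u v Hu Hv; refine (Rle_trans _ _ _ _ (Hd u v Hu Hv)).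
- refine (Rle_trans _ _ _ (Req_le _ _ _) (re_le_Cmod _)).
  f_equal. destruct d as [d1 d2], (F (u, v)), (F (x, y)). simpl. ring.
- refine (Rle_trans _ _ _ (Req_le _ _ _) (im_le_Cmod _)).
  f_equal. destruct d as [d1 d2], (F (u, v)), (F (x, y)). simpl. ring.
Qed.

Lemma cdiff_along_curve (F : C -> C) (g1 g2 : R -> R) (t l1 l2 : R) (d : C) :
  cdiff F (g1 t, g2 t) d -> is_derive g1 t l1 -> is_derive g2 t l2 ->
  is_derive (fun s => Re (F (g1 s, g2 s))) t (Re (d * (l1, l2))) /\
  is_derive (fun s => Im (F (g1 s, g2 s))) t (Im (d * (l1, l2))).
Proof.
intros HF H1 H2. destruct (cdiff_differentiable _ _ _ _ HF) as [HR HI].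
apply is_derive_Reals in H1. apply is_derive_Reals in H2.
split; apply is_derive_Reals.
- replace (Re (d * (l1, l2))) with (Re d * l1 + - Im d * l2) by (unfold Re, Im; simpl; ring).
  apply (derivable_pt_lim_comp_2d (fun u v => Re (F (u, v)))); assumption.
- replace (Im (d * (l1, l2))) with (Im d * l1 + Re d * l2) by (unfold Re, Im; simpl; ring).
  apply (derivable_pt_lim_comp_2d (fun u v => Im (F (u, v)))); assumption.
Qed.

Lemma ccont_continuity_2d (F : C -> C) (g1 g2 : R -> R -> R) (x y : R) :
  ccont F (g1 x y, g2 x y) -> continuity_2d_pt g1 x y -> continuity_2d_pt g2 x y ->
  continuity_2d_pt (fun u v => Re (F (g1 u v, g2 u v))) x y /\
  continuity_2d_pt (fun u v => Im (F (g1 u v, g2 u v))) x y.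
Proof.
intros HF H1 H2. rewrite ccontE in HF.
assert (Hc : forall eps : posreal, locally_2d (fun u v =>
  Cmod (F (g1 u v, g2 u v) - F (g1 x y, g2 x y)) < eps) x y).
{ intros eps. destruct (HF eps (cond_pos eps)) as [delta [Hd Hb]].
  assert (Hd2 : 0 < delta / 2) by lra.
  destruct (H1 (mkposreal _ Hd2)) as [d1 Hd1].
  destruct (H2 (mkposreal _ Hd2)) as [d2 Hd2'].
  assert (Hm : 0 < Rmin d1 d2) by (apply Rmin_pos; apply cond_pos).
  exists (mkposreal _ Hm). simpl. intros u v Hu Hv. apply Hb.
  apply (Cmod_lt_Rmax (g1 u v - g1 x y) (g2 u v - g2 x y)).
  - apply Hd1; apply Rlt_le_trans with (2 := Rmin_l d1 d2); assumption.
  - apply Hd2'; apply Rlt_le_trans with (2 := Rmin_r d1 d2); assumption. }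
split; intros eps; destruct (Hc eps) as [delta Hd]; exists delta;
  intros u v Hu Hv; refine (Rle_lt_trans _ _ _ _ (Hd u v Hu Hv)).
- refine (Rle_trans _ _ _ (Req_le _ _ _) (re_le_Cmod _)). reflexivity.
- refine (Rle_trans _ _ _ (Req_le _ _ _) (im_le_Cmod _)). reflexivity.
Qed.

Lemma continuity_2d_section (f : R -> R -> R) (x y : R) :
  continuity_2d_pt f x y -> continuous (fun v => f x v) y.
Proof.
intros H P [eps HP].
destruct (H eps) as [delta Hd]. exists delta. intros v Hv. apply HP.
apply Hd; [|exact Hv]. rewrite Rminus_diag, Rabs_R0. apply cond_pos.
Qed.

Lemma continuity_2d_polar (x y : R) :
  continuity_2d_pt (fun t s => t * cos s) x y /\
  continuity_2d_pt (fun t s => t * sin s) x y.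
Proof.
split; apply continuity_2d_pt_mult; try apply continuity_2d_pt_id1;
  apply continuity_1d_2d_pt_comp; try apply continuity_2d_pt_id2.
- apply continuity_cos.
- apply continuity_sin.
Qed.

Lemma ccont_polar_Re F r t :
  ccont F (polar r t) -> continuous (fun s => Re (F (polar r s))) t.
Proof.
intros H. destruct (continuity_2d_polar r t) as [H1 H2].
apply (continuity_2d_section (fun u s => Re (F (polar u s)))).
apply (ccont_continuity_2d F (fun t s => t * cos s) (fun t s => t * sin s)); assumption.
Qed.

Lemma ex_RInt_ccont (F : C -> C) (r a b : R) :
  (forall z, Cmod z = Rabs r -> ccont F z) ->
  ex_RInt (fun t => Re (F (polar r t))) a b.
Proof.
intros H. apply (@ex_RInt_continuous R_CompleteNormedModule). intros t _.
apply ccont_polar_Re, H, Cmod_polar.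
Qed.

Lemma holo_ccont F z : holo F -> Cmod z < 1 -> ccont F z.
Proof. intros [dF HF] Hz. destruct (HF z Hz). eapply cdiff_ccont; eassumption. Qed.

(** Along t exp(i s), the angular derivative of Im F is t times the radial
    derivative of Re F.  The integral of the former over a full turn is 0, so
    the circular mean of Re F does not depend on the radius. *)
Lemma mean_value (F : C -> C) (r : R) :
  holo F -> 0 <= r < 1 ->
  RInt (fun t => Re (F (polar r t))) 0 (2 * PI) = 2 * PI * Re (F 0).
Proof.
intros HolF Hr. assert (HolF' := HolF). destruct HolF as [dF HF].
set (J := fun u => RInt (fun t => Re (F (polar u t))) 0 (2 * PI)).
set (D := fun u t => Re (dF (polar u t) * (cos t, sin t))).
assert (Hpol : forall u t, Rabs u < 1 -> Cmod (polar u t) < 1).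
{ intros u t Hu. rewrite Cmod_polar. exact Hu. }
assert (HD : forall u t, Rabs u < 1 ->
  is_derive (fun v => Re (F (polar v t))) u (D u t)).
{ intros u t Hu.
  apply (cdiff_along_curve F (fun v => v * cos t) (fun v => v * sin t)).
  - apply HF, Hpol, Hu.
  - auto_derive; [exact I | ring].
  - auto_derive; [exact I | ring]. }
assert (HT : forall u t, Rabs u < 1 ->
  is_derive (fun s => Im (F (polar u s))) t (u * D u t)).
{ intros u t Hu.
  replace (u * D u t) with (Im (Cmult (dF (polar u t)) (- (u * sin t), u * cos t))).
  2:{ unfold D, Re, Im. simpl. ring. }
  apply (cdiff_along_curve F (fun s => u * cos s) (fun s => u * sin s)).
  - apply HF, Hpol, Hu.
  - auto_derive; [exact I | ring].
  - auto_derive; [exact I | ring]. }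
assert (HC : forall u t, Rabs u < 1 -> continuity_2d_pt D u t).
{ intros u t Hu. destruct (continuity_2d_polar u t) as [H1 H2].
  destruct (ccont_continuity_2d dF _ _ u t (proj2 (HF _ (Hpol u t Hu))) H1 H2)
    as [H3 H4].
  apply (continuity_2d_pt_minus
           (fun u s => Re (dF (polar u s)) * cos s)
           (fun u s => Im (dF (polar u s)) * sin s)).
  - apply continuity_2d_pt_mult; [exact H3|].
    apply continuity_1d_2d_pt_comp; [apply continuity_cos | apply continuity_2d_pt_id2].
  - apply continuity_2d_pt_mult; [exact H4|].
    apply continuity_1d_2d_pt_comp; [apply continuity_sin | apply continuity_2d_pt_id2]. }
assert (Hnear : forall u, Rabs u < 1 -> locally u (fun v => Rabs v < 1)).
{ intros u Hu. assert (Hp : 0 < 1 - Rabs u) by lra.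
  exists (mkposreal _ Hp). intros v Hv.
  change (Rabs (v - u) < 1 - Rabs u) in Hv.
  pose proof (Rabs_triang_inv v u). lra. }
assert (Hloop : forall u, Rabs u < 1 -> u * RInt (D u) 0 (2 * PI) = 0).
{ intros u Hu.
  assert (HDc : forall t, continuous (D u) t).
  { intros t. apply continuity_2d_section, HC, Hu. }
  assert (Hi := is_RInt_derive (fun s => Im (F (polar u s))) (fun s => u * D u s)
                  0 (2 * PI) (fun t _ => HT u t Hu)
                  (fun t _ => continuous_scal_r u (D u) t (HDc t))).
  apply is_RInt_unique in Hi.
  assert (Hx : ex_RInt (D u) 0 (2 * PI)).
  { apply (@ex_RInt_continuous R_CompleteNormedModule). intros; apply HDc. }
  assert (Hs := @RInt_scal R_CompleteNormedModule (D u) 0 (2 * PI) u Hx).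
  change (RInt (fun s => u * D u s) 0 (2 * PI) = u * RInt (D u) 0 (2 * PI)) in Hs.
  rewrite <- Hs.
  etransitivity; [exact Hi|].
  unfold polar. rewrite cos_2PI, sin_2PI, cos_0, sin_0.
  unfold minus, plus, opp; simpl; ring. }
assert (HI : forall u, Rabs u < 1 -> is_derive J u (RInt (D u) 0 (2 * PI))).
{ intros u Hu.
  assert (HE : forall v t, Rabs v < 1 ->
    Derive (fun z => Re (F (polar z t))) v = D v t).
  { intros v t Hv. apply is_derive_unique, HD, Hv. }
  rewrite (RInt_ext (D u) (fun t => Derive (fun z => Re (F (polar z t))) u)).
  2:{ intros t _. symmetry. apply HE, Hu. }
  apply (is_derive_RInt_param (fun u t => Re (F (polar u t)))).
  - refine (filter_imp _ _ _ (Hnear u Hu)). intros v Hv t _.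
    exists (D v t). apply HD, Hv.
  - intros t _. apply continuity_2d_pt_ext_loc with (2 := HC u t Hu).
    destruct (Hnear u Hu) as [delta Hd]. exists delta. intros v s Hv _.
    symmetry. apply HE, Hd, Hv.
  - refine (filter_imp _ _ _ (Hnear u Hu)). intros v Hv.
    apply ex_RInt_ccont. intros z Hz. apply holo_ccont; [exact HolF'|]. lra. }
assert (HI0 : J 0 = 2 * PI * Re (F 0)).
{ unfold J. rewrite (RInt_ext _ (fun _ => Re (F 0))).
  - rewrite RInt_const. unfold scal; simpl. unfold mult; simpl. ring.
  - intros t _. do 2 f_equal. unfold polar. rewrite !Rmult_0_l. reflexivity. }
fold (J r). destruct (Req_dec r 0) as [->|Hr0]; [exact HI0|].
destruct (MVT_cor2 J (fun u => RInt (D u) 0 (2 * PI)) 0 r) as [c [Hc Hc']]; [lra | |].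
- intros c Hc. apply is_derive_Reals, HI. rewrite Rabs_pos_eq; lra.
- assert (RInt (D c) 0 (2 * PI) = 0).
  { apply Rmult_eq_reg_l with c; [|lra]. rewrite Rmult_0_r.
    apply Hloop. rewrite Rabs_pos_eq; lra. }
  rewrite H in Hc. lra.
Qed.

(** * The Schwarz lemma and truncations in mean square *)

Definition ctrunc (b : nat -> C) (n : nat) (z : C) : C :=
  sum_n (fun k => b k * z ^ k)%C n.

Lemma ctrunc_0 b z : ctrunc b 0 z = b 0%nat.
Proof. unfold ctrunc. rewrite sum_O. simpl. ring. Qed.

Lemma ctrunc_S b n z : ctrunc b (S n) z = (ctrunc b n z + b (S n) * z ^ S n)%C.
Proof. unfold ctrunc. rewrite sum_Sn. reflexivity. Qed.

Lemma holo_ctrunc b n : holo (ctrunc b n).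
Proof.
induction n as [|n IH].
- destruct (holo_const (b 0%nat)) as [d Hd]. exists d. intros z Hz.
  destruct (Hd z Hz) as [H1 H2]. split; [|exact H2].
  apply (cdiff_ext_disk (fun _ => b 0%nat) _ z _ 1); [|exact Hz|exact H1].
  intros w _. rewrite ctrunc_0. reflexivity.
- assert (H := holo_plus _ _ IH
     (holo_mult _ _ (holo_const (b (S n))) (holo_pow _ (S n) holo_id))).
  destruct H as [d Hd]. exists d. intros z Hz. destruct (Hd z Hz) as [H1 H2].
  split; [|exact H2].
  apply (cdiff_ext_disk _ (ctrunc b (S n)) z _ 1) in H1; [exact H1| |exact Hz].
  intros w _. rewrite ctrunc_S. reflexivity.
Qed.

Lemma Cmod_sq_plus (x y : C) :
  Cmod (x + y) ^ 2 = Cmod x ^ 2 + 2 * Re (Cconj x * y) + Cmod y ^ 2.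
Proof.
rewrite !Cmod2_alt. destruct x, y. unfold Re, Im, Cconj; simpl. ring.
Qed.

Lemma Re_conj_mult_self (x : C) : Re (Cconj x * x) = Cmod x ^ 2.
Proof. rewrite Cmod2_alt. destruct x. unfold Re, Im; simpl. ring. Qed.

Lemma ccont_conj F z : ccont F z -> ccont (fun w => Cconj (F w)) z.
Proof.
rewrite !ccontE. intros H eps Heps. destruct (H eps Heps) as [d [Hd Hb]].
exists d. split; [exact Hd|]. intros w Hw.
rewrite <- Cminus_conj, Cmod_conj. apply Hb, Hw.
Qed.

Lemma ex_RInt_Cmod2 F r a b :
  holo F -> 0 <= r < 1 -> ex_RInt (fun t => Cmod (F (polar r t)) ^ 2) a b.
Proof.
intros HF Hr.
apply ex_RInt_ext with (fun t => Re ((fun z => Cconj (F z) * F z)%C (polar r t))).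
{ intros t _. apply Re_conj_mult_self. }
apply (ex_RInt_ccont (fun z => Cconj (F z) * F z)%C). intros z Hz.
rewrite Rabs_pos_eq in Hz by lra.
assert (Hc : ccont F z) by (apply holo_ccont; [exact HF | lra]).
apply ccont_mult; [apply ccont_conj|]; exact Hc.
Qed.

(** The real part of the mean value property, applied to F times the conjugate
    of F(0), turns Re into the modulus. *)
Lemma mean_value_bound F r B :
  holo F -> 0 <= r < 1 -> (forall t, Cmod (F (polar r t)) <= B) -> Cmod (F 0) <= B.
Proof.
intros HF Hr HB.
assert (HG := holo_mult _ _ (holo_const (Cconj (F 0))) HF).
assert (E := mean_value _ r HG Hr). cbv beta in E.
rewrite Re_conj_mult_self in E.
assert (HI : RInt (fun t => Re (Cconj (F 0) * F (polar r t))) 0 (2 * PI)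
             <= RInt (fun _ => Cmod (F 0) * B) 0 (2 * PI)).
{ pose proof PI_RGT_0. apply RInt_le; [lra| | |].
  - apply (ex_RInt_ccont (fun z => Cconj (F 0) * F z)%C). intros z Hz.
    rewrite Rabs_pos_eq in Hz by lra.
    apply holo_ccont; [exact HG | lra].
  - apply ex_RInt_const.
  - intros t _. apply Rle_trans with (1 := Rle_abs _).
    apply Rle_trans with (1 := re_le_Cmod _). rewrite Cmod_mult, Cmod_conj.
    apply Rmult_le_compat_l; [apply Cmod_ge_0 | apply HB]. }
rewrite E, RInt_const in HI. unfold scal in HI; simpl in HI. unfold mult in HI; simpl in HI.
rewrite Rminus_0_r in HI. pose proof PI_RGT_0.
apply Rmult_le_reg_l in HI; [|lra].
destruct (Cmod_ge_0 (F 0)) as [Hp|H0].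
- apply Rmult_le_reg_l with (Cmod (F 0)); [exact Hp|]. lra.
- rewrite <- H0. apply Rle_trans with (2 := HB 0). apply Cmod_ge_0.
Qed.

Lemma Cmod_sq_lt_1 z : Cmod z < 1 -> Cmod z ^ 2 < 1.
Proof. pose proof (Cmod_ge_0 z). intros. nra. Qed.

(** It makes z -> (z + a) / (1 + conj(a) z) a self-map of the disk and measures
    how close it gets to the boundary. *)
Lemma moebius_identity (a z : C) :
  Cmod (1 + Cconj a * z) ^ 2 - Cmod (z + a) ^ 2
  = (1 - Cmod a ^ 2) * (1 - Cmod z ^ 2).
Proof.
rewrite !Cmod2_alt. destruct a, z. unfold Re, Im, Cconj; simpl. ring.
Qed.

Lemma moebius_den (a z : C) : Cmod a < 1 -> Cmod z < 1 ->
  1 - Cmod a <= Cmod (1 + Cconj a * z).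
Proof.
intros Ha Hz.
pose proof (Cmod_triangle (1 + Cconj a * z) (- (Cconj a * z))) as H.
replace (1 + Cconj a * z + - (Cconj a * z))%C with (RtoC 1) in H by ring.
rewrite Cmod_1, Cmod_opp, Cmod_mult, Cmod_conj in H.
pose proof (Cmod_ge_0 a). nra.
Qed.

(** The mean value property sees only the centre, so phi is composed with the
    Moebius map M of the disk that sends 0 to a.  On |z| = s one has
    |phi(M z)| <= 1 / |M z|, and |M z| tends to 1 with s. *)
Lemma schwarz_lemma (phi : C -> C) (a : C) :
  holo phi -> (forall z, Cmod z < 1 -> Cmod (z * phi z) <= 1) ->
  Cmod a < 1 -> Cmod (phi a) <= 1.
Proof.
intros Hphi Hb Ha. set (m := Cmod a) in *.
assert (Hm : 0 <= m) by apply Cmod_ge_0.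
set (M := fun z => ((z + a) * / (1 + Cconj a * z))%C).
assert (Hd0 : forall z, Cmod z < 1 -> 0 < Cmod (1 + Cconj a * z)).
{ intros z Hz. pose proof (moebius_den a z Ha Hz). fold m in H. lra. }
assert (Hd : forall z, Cmod z < 1 -> (1 + Cconj a * z)%C <> 0).
{ intros z Hz. apply Cmod_gt_0, Hd0, Hz. }
assert (HM : holo M).
{ apply holo_mult.
  - apply holo_plus; [apply holo_id | apply holo_const].
  - apply holo_inv; [|exact Hd].
    apply holo_plus; [apply holo_const|].
    apply holo_mult; [apply holo_const | apply holo_id]. }
assert (HMm : forall z, Cmod z < 1 ->
  Cmod (M z) ^ 2 * Cmod (1 + Cconj a * z) ^ 2
  = Cmod (1 + Cconj a * z) ^ 2 - (1 - m ^ 2) * (1 - Cmod z ^ 2)).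
{ intros z Hz. unfold m. rewrite <- moebius_identity. unfold M.
  rewrite Cmod_mult, Cmod_inv by (apply Hd, Hz). field. apply Rgt_not_eq, Hd0, Hz. }
assert (HM1 : forall z, Cmod z < 1 -> Cmod (M z) < 1).
{ intros z Hz. specialize (HMm z Hz). specialize (Hd0 z Hz).
  pose proof (Cmod_sq_lt_1 z Hz).
  assert (0 < (1 - m ^ 2) * (1 - Cmod z ^ 2)) by (apply Rmult_lt_0_compat; nra).
  pose proof (Cmod_ge_0 (M z)).
  assert (Cmod (M z) ^ 2 < 1).
  { apply Rmult_lt_reg_r with (Cmod (1 + Cconj a * z) ^ 2); [nra|]. lra. }
  nra. }
assert (HF := holo_comp phi M Hphi HM HM1).
assert (HM0 : M 0 = a).
{ unfold M. field. }
set (k := (1 + m) / (1 - m)).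
assert (Hk : 1 <= k).
{ unfold k. apply Rmult_le_reg_r with (1 - m); [lra|].
  unfold Rdiv. rewrite Rmult_assoc, Rinv_l; lra. }
assert (Hlow : forall z, Cmod z < 1 -> 1 - k * (1 - Cmod z ^ 2) <= Cmod (M z) ^ 2).
{ intros z Hz. specialize (HMm z Hz). specialize (Hd0 z Hz).
  pose proof (moebius_den a z Ha Hz) as H1. fold m in H1.
  pose proof (Cmod_sq_lt_1 z Hz).
  assert (H2 : (1 - m) ^ 2 <= Cmod (1 + Cconj a * z) ^ 2) by nra.
  apply Rmult_le_reg_r with (Cmod (1 + Cconj a * z) ^ 2); [nra|].
  rewrite HMm.
  assert (H3 : 1 - m ^ 2 <= k * Cmod (1 + Cconj a * z) ^ 2).
  { replace (1 - m ^ 2) with (k * (1 - m) ^ 2) by (unfold k; field; lra).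
    apply Rmult_le_compat_l; [lra | exact H2]. }
  nra. }
assert (Hmain : forall e, 0 < e -> k * e < 1 -> Cmod (phi a) ^ 2 * (1 - k * e) <= 1).
{ intros e He Hke.
  assert (He1 : e < 1) by nra.
  set (s := sqrt (1 - e)).
  assert (Hs2 : s ^ 2 = 1 - e).
  { unfold s. rewrite <- Rsqr_pow2. apply Rsqr_sqrt. lra. }
  assert (Hs : 0 <= s) by apply sqrt_pos.
  assert (Hs1 : s < 1) by nra.
  set (q := 1 - k * e) in *.
  assert (Hq : 0 < q) by (unfold q; lra).
  assert (Hsq : 0 < sqrt q) by (apply sqrt_lt_R0; exact Hq).
  assert (Hqq : sqrt q ^ 2 = q).
  { rewrite <- Rsqr_pow2. apply Rsqr_sqrt. lra. }
  assert (Hbd : Cmod (phi (M 0)) <= / sqrt q).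
  { apply (mean_value_bound _ s (/ sqrt q) HF); [lra|]. intros t.
    set (z := polar s t).
    assert (Hz : Cmod z = s) by (unfold z; rewrite Cmod_polar; apply Rabs_pos_eq, Hs).
    assert (Hz1 : Cmod z < 1) by lra.
    specialize (Hb (M z) (HM1 z Hz1)). rewrite Cmod_mult in Hb.
    specialize (Hlow z Hz1). rewrite Hz, Hs2 in Hlow.
    replace (1 - k * (1 - (1 - e))) with q in Hlow by (unfold q; ring).
    assert (Hl : sqrt q <= Cmod (M z)).
    { pose proof (Cmod_ge_0 (M z)). nra. }
    apply Rmult_le_reg_l with (sqrt q); [exact Hsq|].
    rewrite Rinv_r by lra. pose proof (Cmod_ge_0 (phi (M z))). nra. }
  rewrite HM0 in Hbd. rewrite <- Hqq.
  assert (Cmod (phi a) * sqrt q <= 1).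
  { apply Rmult_le_compat_r with (r := sqrt q) in Hbd; [|lra].
    rewrite Rinv_l in Hbd; lra. }
  pose proof (Cmod_ge_0 (phi a)).
  assert (0 <= Cmod (phi a) * sqrt q) by (apply Rmult_le_pos; lra). nra. }
apply Rnot_lt_le. intros Hp.
set (p := Cmod (phi a)) in *.
assert (Hp2 : 1 < p ^ 2) by nra.
(* This e makes p^2 (1 - k e) = (p^2 + 1) / 2, which exceeds 1 if p does. *)
assert (He : 0 < (p ^ 2 - 1) / (2 * p ^ 2 * k)).
{ apply Rdiv_lt_0_compat; [lra|]. nra. }
assert (Ek : k * ((p ^ 2 - 1) / (2 * p ^ 2 * k)) = (1 - / p ^ 2) / 2).
{ field. split; nra. }
assert (Hip : 0 < / p ^ 2) by (apply Rinv_0_lt_compat; lra).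
assert (Hcon := Hmain _ He). rewrite Ek in Hcon.
assert (Ep : p ^ 2 * / p ^ 2 = 1) by (apply Rinv_r; lra).
specialize (Hcon ltac:(lra)). nra.
Qed.

Lemma RInt_plus_R (f g : R -> R) (a b : R) : ex_RInt f a b -> ex_RInt g a b ->
  RInt (fun t => f t + g t) a b = RInt f a b + RInt g a b.
Proof. exact (@RInt_plus R_CompleteNormedModule f g a b). Qed.

Lemma RInt_scal_R (c : R) (f : R -> R) (a b : R) : ex_RInt f a b ->
  RInt (fun t => c * f t) a b = c * RInt f a b.
Proof. exact (@RInt_scal R_CompleteNormedModule f a b c). Qed.

Lemma polar_conj r t : (Cconj (polar r t) * polar r t = RtoC (r ^ 2))%C.
Proof.
unfold polar, Cconj, RtoC, Cmult; simpl. pose proof (sin2_cos2 t) as H.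
unfold Rsqr in H. f_equal; [|ring].
transitivity (r * r * (sin t * sin t + cos t * cos t)); [ring|rewrite H; ring].
Qed.

(** On |z| = r, conj(z)^k z^m = r^(2k) z^(m - k), so the integrand is the real part of
    a function that vanishes at 0. *)
Lemma orthogonal_powers (Psi : C -> C) (r : R) (k m : nat) :
  holo Psi -> 0 <= r < 1 -> (k < m)%nat ->
  RInt (fun t => Re (Cconj (polar r t ^ k) * (polar r t ^ m * Psi (polar r t)))) 0 (2 * PI)
  = 0.
Proof.
intros HP Hr Hkm.
(* F agrees with the integrand on |z| = r and is analytic, unlike conj(z)^k. *)
set (F := fun z => (RtoC (r ^ 2) ^ k * (z ^ (m - k) * Psi z))%C).
assert (HF : holo F).
{ apply holo_mult; [apply holo_const|].
  apply holo_mult; [apply holo_pow, holo_id | exact HP]. }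
rewrite (RInt_ext _ (fun t => Re (F (polar r t)))).
- rewrite mean_value by assumption. unfold F.
  destruct (m - k)%nat as [|j] eqn:E; [lia|].
  rewrite Cpow_S, !Cmult_0_l, Cmult_0_r. simpl. ring.
- intros t _. unfold F. f_equal. rewrite Cpow_conj, <- (polar_conj r t), Cpow_mult_l.
  replace m with (k + (m - k))%nat at 1 by lia. rewrite Cpow_add_r. ring.
Qed.

Lemma orthogonal_ctrunc (c : nat -> C) (Psi : C -> C) (r : R) (n m : nat) :
  holo Psi -> 0 <= r < 1 -> (n < m)%nat ->
  RInt (fun t => Re (Cconj (ctrunc c n (polar r t)) * (polar r t ^ m * Psi (polar r t))))
    0 (2 * PI) = 0.
Proof.
intros HP Hr.
assert (Hex : forall (G : C -> C), holo G ->
   ex_RInt (fun t => Re (Cconj (G (polar r t)) * (polar r t ^ m * Psi (polar r t)))) 0 (2 * PI)).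
{ intros G HG.
  apply (ex_RInt_ccont (fun z => Cconj (G z) * (z ^ m * Psi z))%C).
  intros z Hz. rewrite Rabs_pos_eq in Hz by lra.
  apply ccont_mult; [apply ccont_conj, holo_ccont; [exact HG|lra]|].
  apply holo_ccont; [|lra]. apply holo_mult; [apply holo_pow, holo_id | exact HP]. }
assert (Hmono : forall a k, (k < m)%nat ->
  RInt (fun t => Re (Cconj (a * polar r t ^ k) * (polar r t ^ m * Psi (polar r t))))
    0 (2 * PI) = 0).
{ intros a k Hk.
  rewrite (RInt_ext _ (fun t => Re (Cconj (polar r t ^ k) *
    (polar r t ^ m * (fun z => Cconj a * Psi z)%C (polar r t))))).
  - apply (orthogonal_powers (fun z => Cconj a * Psi z)%C); [|exact Hr|exact Hk].
    apply holo_mult; [apply holo_const | exact HP].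
  - intros t _. f_equal. rewrite Cmult_conj. ring. }
induction n as [|n IH]; intros Hn.
- rewrite (RInt_ext _ (fun t => Re (Cconj (c 0%nat * polar r t ^ 0) *
    (polar r t ^ m * Psi (polar r t))))).
  + apply Hmono, Hn.
  + intros t _. rewrite ctrunc_0. change (polar r t ^ 0)%C with (RtoC 1).
    rewrite Cmult_1_r. reflexivity.
- rewrite (RInt_ext _ (fun t =>
    Re (Cconj (ctrunc c n (polar r t)) * (polar r t ^ m * Psi (polar r t)))
    + Re (Cconj (c (S n) * polar r t ^ S n) * (polar r t ^ m * Psi (polar r t))))).
  + rewrite RInt_plus_R.
    * rewrite IH by lia. rewrite Hmono by exact Hn. apply Rplus_0_l.
    * apply (Hex (ctrunc c n)), holo_ctrunc.
    * apply (Hex (fun z => c (S n) * z ^ S n)%C).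
      apply holo_mult; [apply holo_const | apply holo_pow, holo_id].
  + intros t _. rewrite ctrunc_S, Cplus_conj, Cmult_plus_distr_r, re_plus. reflexivity.
Qed.

Lemma pythagoras_ctrunc (c : nat -> C) (Psi : C -> C) (r : R) (n : nat) :
  holo Psi -> 0 <= r < 1 ->
  RInt (fun t => Cmod (ctrunc c n (polar r t) + polar r t ^ S n * Psi (polar r t)) ^ 2)
    0 (2 * PI)
  = RInt (fun t => Cmod (ctrunc c n (polar r t)) ^ 2) 0 (2 * PI)
    + RInt (fun t => Cmod (polar r t ^ S n * Psi (polar r t)) ^ 2) 0 (2 * PI).
Proof.
intros HP Hr.
assert (HT : holo (fun z => z ^ S n * Psi z)%C).
{ apply holo_mult; [apply holo_pow, holo_id | exact HP]. }
assert (H0 := orthogonal_ctrunc c Psi r n (S n) HP Hr (Nat.lt_succ_diag_r n)).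
assert (Hc : ex_RInt (fun t => Re (Cconj (ctrunc c n (polar r t))
   * (polar r t ^ S n * Psi (polar r t)))) 0 (2 * PI)).
{ apply (ex_RInt_ccont (fun z => Cconj (ctrunc c n z) * (z ^ S n * Psi z))%C).
  intros z Hz. rewrite Rabs_pos_eq in Hz by lra.
  apply ccont_mult; [apply ccont_conj|]; apply holo_ccont; try lra.
  - apply holo_ctrunc.
  - exact HT. }
assert (H1 := ex_RInt_Cmod2 _ r 0 (2 * PI) (holo_ctrunc c n) Hr).
assert (H2 := ex_RInt_Cmod2 _ r 0 (2 * PI) HT Hr). cbv beta in H2.
rewrite (RInt_ext _ (fun t =>
  Cmod (ctrunc c n (polar r t)) ^ 2
  + 2 * Re (Cconj (ctrunc c n (polar r t)) * (polar r t ^ S n * Psi (polar r t)))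
  + Cmod (polar r t ^ S n * Psi (polar r t)) ^ 2)).
2:{ intros t _. apply Cmod_sq_plus. }
assert (Hc2 := @ex_RInt_scal R_CompleteNormedModule _ 0 (2 * PI) 2 Hc).
rewrite RInt_plus_R; [|exact (@ex_RInt_plus R_CompleteNormedModule _ _ _ _ H1 Hc2)|exact H2].
rewrite RInt_plus_R; [|exact H1|exact Hc2].
rewrite RInt_scal_R by exact Hc. rewrite H0, Rmult_0_r, Rplus_0_r. reflexivity.
Qed.

Lemma parseval_ctrunc (c : nat -> C) (r : R) (n : nat) : 0 <= r < 1 ->
  RInt (fun t => Cmod (ctrunc c n (polar r t)) ^ 2) 0 (2 * PI)
  = 2 * PI * sum_n (fun k => (Cmod (c k) * r ^ k) ^ 2) n.
Proof.
intros Hr. induction n as [|n IH].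
- rewrite (RInt_ext _ (fun _ => Cmod (c 0%nat) ^ 2)).
  + rewrite RInt_const, sum_O. unfold scal; simpl. unfold mult; simpl. ring.
  + intros t _. rewrite ctrunc_0. reflexivity.
- rewrite (RInt_ext _ (fun t => Cmod (ctrunc c n (polar r t)
     + polar r t ^ S n * (fun _ => c (S n)) (polar r t)) ^ 2)).
  2:{ intros t _. rewrite ctrunc_S. do 3 f_equal. ring. }
  etransitivity;
    [exact (pythagoras_ctrunc c (fun _ => c (S n)) r n (holo_const _) Hr)|].
  cbv beta.
  rewrite IH, sum_Sn.
  rewrite (RInt_ext _ (fun _ => (Cmod (c (S n)) * r ^ S n) ^ 2)).
  + rewrite RInt_const. unfold scal, plus; simpl. unfold mult; simpl. ring.
  + intros t _. rewrite Cmod_mult, Cmod_pow, Cmod_polar, Rabs_pos_eq by lra.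
    f_equal. ring.
Qed.

(** Up to degree n + 1, omega times the truncation of the second series is the
    truncation of the first; the remainder is orthogonal to it, so dropping it
    lowers the mean square, and |omega| <= 1 lowers it too. *)
Lemma clunie_truncation (c d : nat -> C) (omega Psi : C -> C) (r : R) (n : nat) :
  holo omega -> (forall z, Cmod z < 1 -> Cmod (omega z) <= 1) -> holo Psi ->
  (forall z, Cmod z < 1 ->
     (ctrunc c (S n) z + z ^ S (S n) * Psi z = omega z * ctrunc d n z)%C) ->
  0 <= r < 1 ->
  sum_n (fun k => (Cmod (c k) * r ^ k) ^ 2) (S n)
  <= sum_n (fun k => (Cmod (d k) * r ^ k) ^ 2) n.
Proof.
intros Ho Ho1 HP E Hr. pose proof PI_RGT_0 as HPI.
apply Rmult_le_reg_l with (2 * PI); [lra|].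
rewrite <- !parseval_ctrunc by exact Hr.
assert (Hpol : forall t, Cmod (polar r t) < 1).
{ intros t. rewrite Cmod_polar, Rabs_pos_eq; lra. }
assert (HT : holo (fun z => z ^ S (S n) * Psi z)%C).
{ apply holo_mult; [apply holo_pow, holo_id | exact HP]. }
apply Rle_trans with
  (RInt (fun t => Cmod (ctrunc c (S n) (polar r t)
     + polar r t ^ S (S n) * Psi (polar r t)) ^ 2) 0 (2 * PI)).
- rewrite pythagoras_ctrunc by assumption.
  assert (0 <= RInt (fun t => Cmod (polar r t ^ S (S n) * Psi (polar r t)) ^ 2) 0 (2 * PI)).
  { apply RInt_ge_0; [lra| |intros; apply pow2_ge_0].
    apply (ex_RInt_Cmod2 _ r 0 (2 * PI) HT Hr). }
  lra.
- apply RInt_le; [lra| | |].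
  + apply (ex_RInt_Cmod2 (fun z => ctrunc c (S n) z + z ^ S (S n) * Psi z)%C); [|exact Hr].
    apply holo_plus; [apply holo_ctrunc | exact HT].
  + apply ex_RInt_Cmod2; [apply holo_ctrunc | exact Hr].
  + intros t _. rewrite E by apply Hpol. rewrite Cmod_mult.
    specialize (Ho1 _ (Hpol t)). pose proof (Cmod_ge_0 (omega (polar r t))).
    pose proof (Cmod_ge_0 (ctrunc d n (polar r t))).
    apply pow_incr. nra.
Qed.

(** * Power series on the unit disk *)

Definition cseries (u : nat -> C) (l : C) : Prop :=
  @is_series C_AbsRing C_NormedModule u l.

Lemma cseriesE (u : nat -> C) (l : C) :
  cseries u l <->
  forall eps : R, 0 < eps ->
    exists N, forall n, (N <= n)%nat -> Cmod (sum_n u n - l) < eps.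
Proof.
pose proof (@filterlim_locally_ball_norm C_AbsRing nat C_NormedModule
              Hierarchy.eventually _ (sum_n u) l) as [H1 H2].
split.
- intros H eps Heps. exact (H1 H (mkposreal eps Heps)).
- intros H. apply H2. intros eps. exact (H eps (cond_pos eps)).
Qed.

Lemma cseries_unique u l1 l2 : cseries u l1 -> cseries u l2 -> l1 = l2.
Proof.
exact (@filterlim_locally_unique nat C_AbsRing C_NormedModule
         Hierarchy.eventually _ (sum_n u) l1 l2).
Qed.

Lemma sum_n_Cmod_le (u : nat -> C) (v : nat -> R) n :
  (forall k, Cmod (u k) <= v k) -> Cmod (sum_n u n) <= sum_n v n.
Proof.
intros H. induction n as [|n IH].
- rewrite !sum_O. apply H.
- rewrite !sum_Sn. apply Rle_trans with (1 := Cmod_triangle _ _).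
  apply Rplus_le_compat; [exact IH | apply H].
Qed.

Lemma cseries_Cmod_le u l M :
  cseries u l -> (forall n, Cmod (sum_n u n) <= M) -> Cmod l <= M.
Proof.
rewrite cseriesE. intros H HM. apply le_epsilon. intros eps Heps.
destruct (H eps Heps) as [N HN]. specialize (HN N (Nat.le_refl N)).
pose proof (Cmod_triangle (sum_n u N) (- (sum_n u N - l))) as Ht.
rewrite Cmod_opp in Ht.
replace (sum_n u N + - (sum_n u N - l))%C with l in Ht by ring.
specialize (HM N). lra.
Qed.

Lemma sum_n_nonneg_le_Series (v : nat -> R) n :
  (forall k, 0 <= v k) -> ex_series v -> sum_n v n <= Series v.
Proof.
intros Hp Hs. apply (is_lim_seq_incr_compare (sum_n v) (Series v)).
- exact (Series_correct v Hs).
- intros k. rewrite sum_Sn. unfold plus; simpl. specialize (Hp (S k)). lra.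
Qed.

(** Passing to moduli gives access to the theory of real power series, whose
    radius of convergence is unchanged by differentiation and shifts. *)
Definition abs_radius_ge_1 (b : nat -> C) : Prop :=
  Rbar_le 1 (CV_radius (fun n => Cmod (b n))).

Lemma abs_radius_summable b r : abs_radius_ge_1 b -> 0 <= r < 1 ->
  ex_series (fun n => Cmod (b n) * r ^ n).
Proof.
intros Hb Hr. apply ex_series_ext with (fun n => Rabs (Cmod (b n) * r ^ n)).
{ intros n. apply Rabs_pos_eq, Rmult_le_pos; [apply Cmod_ge_0 | apply pow_le, Hr]. }
apply CV_disk_inside. apply (Rbar_lt_le_trans _ 1 _ ) with (2 := Hb). simpl.
rewrite Rabs_pos_eq; lra.
Qed.

Definition cderiv_coef (b : nat -> C) (n : nat) : C := (INR (S n) * b (S n))%C.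

Lemma abs_radius_deriv b : abs_radius_ge_1 b -> abs_radius_ge_1 (cderiv_coef b).
Proof.
unfold abs_radius_ge_1. intros H.
rewrite (CV_radius_ext _ (PS_derive (fun n => Cmod (b n)))).
- rewrite CV_radius_derive. exact H.
- intros n. unfold cderiv_coef, PS_derive. rewrite Cmod_mult, Cmod_R.
  f_equal. apply Rabs_pos_eq, pos_INR.
Qed.

Lemma abs_radius_shift b m : abs_radius_ge_1 b -> abs_radius_ge_1 (fun k => b (m + k)%nat).
Proof.
unfold abs_radius_ge_1. intros H. induction m as [|m IH]; [exact H|].
rewrite (CV_radius_ext _ (PS_decr_1 (fun k => Cmod (b (m + k)%nat)))).
- rewrite CV_radius_decr_1. exact IH.
- intros k. unfold PS_decr_1. f_equal. f_equal. lia.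
Qed.

Lemma pow_n_Cpow (z : C) n : @pow_n C_AbsRing z n = (z ^ n)%C.
Proof. induction n as [|n IH]; [reflexivity|]. simpl. rewrite IH. reflexivity. Qed.

(** The terms of a convergent series are bounded, and bounded terms at every
    r < 1 force radius at least 1. *)
Lemma abs_radius_of_pseries (b : nat -> C) (f : C -> C) :
  (forall z, Cmod z < 1 -> @is_pseries C_AbsRing C_NormedModule b z (f z)) ->
  abs_radius_ge_1 b.
Proof.
intros H. unfold abs_radius_ge_1.
assert (Hr : forall r, 0 <= r < 1 -> Rbar_le r (CV_radius (fun n => Cmod (b n)))).
{ intros r Hr. apply (proj1 (CV_radius_bounded (fun n => Cmod (b n)))).
  assert (Hs := H (RtoC r)). rewrite Cmod_R, Rabs_pos_eq in Hs by lra.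
  specialize (Hs (proj2 Hr)).
  change (cseries (fun k => scal (pow_n (RtoC r : C_AbsRing) k) (b k)) (f r)) in Hs.
  rewrite cseriesE in Hs. destruct (Hs 1 Rlt_0_1) as [N HN].
  assert (Ht : forall n, (N < n)%nat -> Rabs (Cmod (b n) * r ^ n) <= 2).
  { intros n Hn. destruct n as [|n]; [lia|].
    pose proof (HN n ltac:(lia)) as H1. pose proof (HN (S n) ltac:(lia)) as H2.
    rewrite sum_Sn in H2.
    set (s := sum_n _ n) in *.
    change (plus s (scal (pow_n (RtoC r : C_AbsRing) (S n)) (b (S n))))
      with (s + @pow_n C_AbsRing (RtoC r) (S n) * b (S n))%C in H2.
    rewrite pow_n_Cpow in H2.
    pose proof (Cmod_triangle (s + r ^ S n * b (S n) - f r) (- (s - f r))) as Hq.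
    rewrite Cmod_opp in Hq.
    replace (s + r ^ S n * b (S n) - f r + - (s - f r))%C with (r ^ S n * b (S n))%C in Hq by ring.
    rewrite Cmod_mult, Cmod_pow, Cmod_R, (Rabs_pos_eq r) in Hq by lra.
    rewrite Rabs_pos_eq, Rmult_comm; [lra|].
    apply Rmult_le_pos; [apply Cmod_ge_0 | apply pow_le, Hr]. }
  assert (Hi : forall m, exists M, forall n, (n <= m)%nat -> Rabs (Cmod (b n) * r ^ n) <= M).
  { induction m as [|m [M IH]].
    - exists (Rabs (Cmod (b 0%nat) * r ^ 0)). intros n Hn.
      replace n with 0%nat by lia. lra.
    - exists (Rmax M (Rabs (Cmod (b (S m)) * r ^ S m))). intros n Hn.
      destruct (Nat.eq_dec n (S m)) as [->|Hne]; [apply Rmax_r|].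
      apply Rle_trans with (2 := Rmax_l _ _). apply IH. lia. }
  destruct (Hi N) as [M HM]. exists (Rmax M 2). intros n.
  destruct (Nat.le_gt_cases n N).
  - apply Rle_trans with (2 := Rmax_l _ _). apply HM; assumption.
  - apply Rle_trans with (2 := Rmax_r _ _). apply Ht; assumption. }
destruct (CV_radius (fun n => Cmod (b n))) as [R| |]; simpl in *; [|exact I|].
- apply Rnot_lt_le. intros HR.
  pose proof (Hr 0 ltac:(lra)). pose proof (Hr ((R + 1) / 2) ltac:(lra)). lra.
- exact (Hr 0 ltac:(lra)).
Qed.

(** Total by componentwise summation; the sum of the series only inside its disk
    of convergence, by [csum_correct]. *)
Definition csum (b : nat -> C) (z : C) : C :=
  (Series (fun n => Re (b n * z ^ n)), Series (fun n => Im (b n * z ^ n))).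

Lemma sum_n_components (u : nat -> C) n :
  sum_n u n = (sum_n (fun k => Re (u k)) n, sum_n (fun k => Im (u k)) n).
Proof.
induction n as [|n IH].
- rewrite !sum_O. apply surjective_pairing.
- rewrite !sum_Sn, IH. reflexivity.
Qed.

Lemma csum_correct b z : abs_radius_ge_1 b -> Cmod z < 1 ->
  cseries (fun n => b n * z ^ n)%C (csum b z).
Proof.
intros Hb Hz.
assert (Hs := abs_radius_summable b (Cmod z) Hb (conj (Cmod_ge_0 z) Hz)).
assert (Hu : forall n, Cmod (b n * z ^ n) = Cmod (b n) * Cmod z ^ n).
{ intros n. rewrite Cmod_mult, Cmod_pow. reflexivity. }
destruct (@ex_series_le C_AbsRing C_CompleteNormedModule
  (fun n => b n * z ^ n)%C _ (fun n => Req_le _ _ (Hu n)) Hs) as [l Hl].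
replace (csum b z) with l; [exact Hl|].
assert (He := proj1 (cseriesE _ _) Hl).
unfold csum. rewrite (surjective_pairing l). f_equal; symmetry; apply is_series_unique;
  apply filterlim_locally; intros eps; destruct (He eps (cond_pos eps)) as [N HN];
  exists N; intros n Hn; specialize (HN n Hn); rewrite sum_n_components in HN.
- exact (Rle_lt_trans _ _ _ (re_le_Cmod _) HN).
- exact (Rle_lt_trans _ _ _ (im_le_Cmod _) HN).
Qed.

Lemma csum_unique b z l : abs_radius_ge_1 b -> Cmod z < 1 ->
  cseries (fun n => b n * z ^ n)%C l -> csum b z = l.
Proof.
intros Hb Hz H. exact (cseries_unique _ _ _ (csum_correct b z Hb Hz) H).
Qed.

Lemma csum_of_pseries b z l : abs_radius_ge_1 b -> Cmod z < 1 ->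
  @is_pseries C_AbsRing C_NormedModule b z l -> csum b z = l.
Proof.
intros Hb Hz H. apply csum_unique; [exact Hb | exact Hz|].
refine (is_series_ext _ _ _ _ H). intros n.
change (@pow_n C_AbsRing z n * b n = b n * z ^ n)%C. rewrite pow_n_Cpow. ring.
Qed.

Lemma cseries_scal c u l : cseries u l -> cseries (fun n => c * u n)%C (c * l)%C.
Proof. exact (@is_series_scal C_AbsRing C_NormedModule c u l). Qed.

Lemma cseries_plus u v l m :
  cseries u l -> cseries v m -> cseries (fun n => u n + v n)%C (l + m)%C.
Proof. exact (@is_series_plus C_AbsRing C_NormedModule u v l m). Qed.

Lemma cseries_ext u v l : (forall n, u n = v n) -> cseries u l -> cseries v l.
Proof. exact (@is_series_ext C_AbsRing C_NormedModule u v l). Qed.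

Lemma csum_split b n z : abs_radius_ge_1 b -> Cmod z < 1 ->
  csum b z = (ctrunc b n z + z ^ S n * csum (fun k => b (S n + k)%nat) z)%C.
Proof.
intros Hb Hz. apply csum_unique; [exact Hb | exact Hz|].
assert (Hs := cseries_scal (z ^ S n) _ _
   (csum_correct _ z (abs_radius_shift b (S n) Hb) Hz)).
refine (@is_series_decr_n C_AbsRing C_NormedModule _ (S n) _ (Nat.lt_0_succ n) _).
refine (cseries_ext _ _ _ _ _).
2:{ match type of Hs with cseries _ ?l => match goal with |- cseries _ ?m =>
    replace m with l; [exact Hs|] end end.
    change (z ^ S n * csum (fun k => b (S n + k)%nat) z
     = ctrunc b n z + z ^ S n * csum (fun k => b (S n + k)%nat) z + - ctrunc b n z)%C.
    ring. }
intros k. cbv beta. rewrite Cpow_add_r. ring.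
Qed.

(** With E_k the second-order Taylor remainder of the k-th power,
    E_(k+1) = w E_k + k z^(k-1) (w - z)^2, and the bound follows by induction. *)
Lemma Cpow_taylor2 (w z : C) (rho : R) (j : nat) :
  Cmod w <= rho -> Cmod z <= rho ->
  Cmod (w ^ S (S j) - z ^ S (S j) - INR (S (S j)) * z ^ S j * (w - z))
  <= INR (S (S j)) * INR (S j) * rho ^ j * Cmod (w - z) ^ 2.
Proof.
intros Hw Hz.
assert (Hrho : 0 <= rho) by (apply Rle_trans with (1 := Cmod_ge_0 w); exact Hw).
induction j as [|j IH].
- replace (w ^ 2 - z ^ 2 - INR 2 * z ^ 1 * (w - z))%C with ((w - z) * (w - z))%C.
  + rewrite Cmod_mult. simpl. pose proof (Cmod_ge_0 (w - z)). nra.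
  + replace (RtoC (INR 2)) with (RtoC 1 + RtoC 1)%C.
    * simpl. ring.
    * rewrite <- RtoC_plus. reflexivity.
- replace (w ^ S (S (S j)) - z ^ S (S (S j)) - INR (S (S (S j))) * z ^ S (S j) * (w - z))%C
    with (w * (w ^ S (S j) - z ^ S (S j) - INR (S (S j)) * z ^ S j * (w - z))
          + INR (S (S j)) * z ^ S j * ((w - z) * (w - z)))%C.
  2:{ rewrite (S_INR (S (S j))), RtoC_plus, !Cpow_S. ring. }
  apply Rle_trans with (1 := Cmod_triangle _ _).
  rewrite !Cmod_mult, Cmod_pow, Cmod_R, (Rabs_pos_eq (INR _)) by apply pos_INR.
  set (h := Cmod (w - z)) in *. assert (Hh : 0 <= h) by apply Cmod_ge_0.
  apply Rle_trans with
    (rho * (INR (S (S j)) * INR (S j) * rho ^ j * h ^ 2)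
     + INR (S (S j)) * rho ^ S j * (h * h)).
  + apply Rplus_le_compat.
    * apply Rmult_le_compat; try apply Cmod_ge_0; assumption.
    * apply Rmult_le_compat_r; [nra|]. apply Rmult_le_compat_l; [apply pos_INR|].
      apply pow_incr. split; [apply Cmod_ge_0 | exact Hz].
  + rewrite (S_INR (S (S j))), (S_INR (S j)). set (x := INR (S j)).
    assert (Hx : 0 <= x) by apply pos_INR. simpl (rho ^ S j).
    assert (0 <= rho * rho ^ j * (h * h)).
    { apply Rmult_le_pos; [apply Rmult_le_pos; [exact Hrho|apply pow_le, Hrho]|nra]. }
    nra.
Qed.

(** Summing [Cpow_taylor2] bounds the first-order remainder by M |w - z|^2, where
    M is the absolutely convergent second derivative series at a radius
    slightly larger than |z|. *)
Lemma csum_cdiff b z : abs_radius_ge_1 b -> Cmod z < 1 ->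
  cdiff (csum b) z (csum (cderiv_coef b) z).
Proof.
intros Hb Hz. apply cdiffE. intros eps Heps.
set (rho := (1 + Cmod z) / 2).
assert (Hrho : Cmod z < rho < 1) by (unfold rho; lra).
assert (Hz0 := Cmod_ge_0 z).
set (v := fun j => Cmod (cderiv_coef (cderiv_coef b) j) * rho ^ j).
assert (Hv : ex_series v).
{ apply abs_radius_summable; [|lra]. apply abs_radius_deriv, abs_radius_deriv, Hb. }
assert (Hv0 : forall j, 0 <= v j).
{ intros j. apply Rmult_le_pos; [apply Cmod_ge_0 | apply pow_le; lra]. }
set (M := Series v).
assert (HM : 0 <= M).
{ apply Rle_trans with (2 := sum_n_nonneg_le_Series v 0 Hv0 Hv).
  rewrite sum_O. apply Hv0. }
assert (HM1 : 0 < M + 1) by lra.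
exists (Rmin (rho - Cmod z) (eps / (M + 1))). split.
{ apply Rmin_pos; [lra|]. apply Rdiv_lt_0_compat; lra. }
intros w Hw.
assert (Hw1 := Rlt_le_trans _ _ _ Hw (Rmin_l _ _)).
assert (Hw2 := Rlt_le_trans _ _ _ Hw (Rmin_r _ _)).
assert (Hwr : Cmod w < rho).
{ pose proof (Cmod_triangle (w - z) z) as H.
  replace (w - z + z)%C with w in H by ring. lra. }
set (h := Cmod (w - z)) in *.
assert (Hh : 0 <= h) by apply Cmod_ge_0.
assert (Hq : Cmod (csum b w - csum b z - csum (cderiv_coef b) z * (w - z)) <= M * h ^ 2).
{ set (E := fun j => (b (S (S j)) *
     (w ^ S (S j) - z ^ S (S j) - INR (S (S j)) * z ^ S j * (w - z)))%C).
  apply (cseries_Cmod_le E).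
  - rewrite (csum_split b 1 w Hb), (csum_split b 1 z Hb),
      (csum_split (cderiv_coef b) 0 z (abs_radius_deriv b Hb)) by lra.
    rewrite !ctrunc_S, !ctrunc_0.
    assert (S1 := cseries_scal (w ^ 2) _ _
      (csum_correct _ w (abs_radius_shift b 2 Hb) ltac:(lra))).
    assert (S2 := cseries_scal (- z ^ 2) _ _
      (csum_correct _ z (abs_radius_shift b 2 Hb) ltac:(lra))).
    assert (S3 := cseries_scal (- (z * (w - z))) _ _ (csum_correct _ z
      (abs_radius_shift (cderiv_coef b) 1 (abs_radius_deriv b Hb)) ltac:(lra))).
    assert (S4 := cseries_plus _ _ _ _ (cseries_plus _ _ _ _ S1 S2) S3).
    match type of S4 with cseries _ ?l => match goal with |- cseries _ ?m =>
      replace m with l end end.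
    + refine (cseries_ext _ _ _ _ S4). intros j. unfold E, cderiv_coef.
      simpl (1 + j)%nat. simpl (2 + j)%nat. rewrite !Cpow_S.
      simpl (w ^ 0)%C. simpl (z ^ 0)%C. ring.
    + unfold cderiv_coef. change (INR 1) with 1. rewrite !Cpow_S.
      simpl (w ^ 0)%C. simpl (z ^ 0)%C. ring.
  - intros n. apply Rle_trans with (sum_n (fun j => h ^ 2 * v j) n).
    + apply sum_n_Cmod_le. intros j. unfold E. rewrite Cmod_mult.
      apply Rle_trans with (1 := Rmult_le_compat_l _ _ _ (Cmod_ge_0 _)
        (Cpow_taylor2 w z rho j (Rlt_le _ _ Hwr) (Rlt_le _ _ (proj1 Hrho)))).
      apply Req_le. unfold v, cderiv_coef.
      rewrite !Cmod_mult, !Cmod_R, !(Rabs_pos_eq (INR _)) by apply pos_INR.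
      fold h. ring.
    + apply Rle_trans with (1 := Req_le _ _ (@sum_n_mult_l R_Ring (h ^ 2) v n)).
      change (h ^ 2 * sum_n v n <= M * h ^ 2).
      rewrite Rmult_comm. apply Rmult_le_compat_r; [nra|].
      apply sum_n_nonneg_le_Series; assumption. }
apply Rle_trans with (1 := Hq).
assert (Hmul : h * (M + 1) <= eps).
{ apply Rmult_lt_compat_r with (r := M + 1) in Hw2; [|exact HM1].
  unfold Rdiv in Hw2. rewrite Rmult_assoc, Rinv_l in Hw2 by lra. lra. }
nra.
Qed.

Lemma holo_csum b : abs_radius_ge_1 b -> holo (csum b).
Proof.
intros Hb. exists (csum (cderiv_coef b)). intros z Hz. split.
- apply csum_cdiff; assumption.
- eapply cdiff_ccont, csum_cdiff; [apply abs_radius_deriv, Hb | exact Hz].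
Qed.

(** * The coefficient bound *)

(** [b] lists the coefficients of f' for an f in G(alpha). *)
Definition derivative_in_G (alpha : R) (b : nat -> C) : Prop :=
  abs_radius_ge_1 b /\ b 0%nat = RtoC 1 /\
  forall z, Cmod z < 1 -> csum b z <> 0 /\
    Re (z * csum (cderiv_coef b) z / csum b z) < alpha / 2.

(** Nonzero on the disk because it dominates z g' strictly; the quotient
    g' / (z g' - alpha g) is then analytic. *)
Definition clunie_den (alpha : R) (b : nat -> C) (z : C) : C :=
  (z * csum (cderiv_coef b) z + - alpha * csum b z)%C.

(** Re P < alpha / 2 says that P is closer to 0 than to alpha. *)
Lemma half_plane_Cmod (alpha : R) (A g : C) :
  0 < alpha -> g <> 0 -> Re (A / g) < alpha / 2 -> Cmod A < Cmod (A + - alpha * g).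
Proof.
intros Ha Hg HP. set (P := (A / g)%C) in *.
assert (EA : A = (P * g)%C) by (unfold P; field; exact Hg).
replace (A + - alpha * g)%C with ((P - alpha) * g)%C by (rewrite EA; ring).
rewrite EA, !Cmod_mult. apply Rmult_lt_compat_r; [apply Cmod_gt_0, Hg|].
assert (H : Cmod P ^ 2 < Cmod (P - alpha) ^ 2).
{ rewrite !Cmod2_alt. destruct P as [p1 p2]. unfold Re, Im in *; simpl in *. nra. }
pose proof (Cmod_ge_0 P). pose proof (Cmod_ge_0 (P - alpha)). nra.
Qed.

Lemma clunie_den_gt alpha b z : 0 < alpha -> derivative_in_G alpha b -> Cmod z < 1 ->
  Cmod (z * csum (cderiv_coef b) z) < Cmod (clunie_den alpha b z).
Proof.
intros Hal Hb Hz. destruct Hb as [_ [_ H]]. destruct (H z Hz) as [H1 H2].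
apply half_plane_Cmod; [exact Hal | exact H1 | exact H2].
Qed.

Lemma clunie_den_neq_0 alpha b z : 0 < alpha -> derivative_in_G alpha b -> Cmod z < 1 ->
  clunie_den alpha b z <> 0.
Proof.
intros Hal Hb Hz. apply Cmod_gt_0.
apply Rle_lt_trans with (2 := clunie_den_gt alpha b z Hal Hb Hz). apply Cmod_ge_0.
Qed.

Definition clunie_quot (alpha : R) (b : nat -> C) (z : C) : C :=
  (csum (cderiv_coef b) z * / clunie_den alpha b z)%C.

Lemma holo_clunie_quot alpha b : 0 < alpha -> derivative_in_G alpha b ->
  holo (clunie_quot alpha b).
Proof.
intros Hal Hb. assert (H := proj1 Hb). assert (H' := abs_radius_deriv _ H).
apply holo_mult; [apply holo_csum, H'|].
apply holo_inv; [|intros z Hz; apply clunie_den_neq_0; assumption].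
apply holo_plus; apply holo_mult.
- apply holo_id.
- apply holo_csum, H'.
- apply holo_const.
- apply holo_csum, H.
Qed.

Lemma omega_le_1 alpha b z : 0 < alpha -> derivative_in_G alpha b -> Cmod z < 1 ->
  Cmod (z * clunie_quot alpha b z) <= 1.
Proof.
intros Hal Hb Hz. set (A := (z * csum (cderiv_coef b) z)%C).
replace (z * clunie_quot alpha b z)%C with (A / clunie_den alpha b z)%C
  by (unfold A, clunie_quot, Cdiv; ring).
rewrite Cmod_div by (apply clunie_den_neq_0; assumption).
pose proof (clunie_den_gt alpha b z Hal Hb Hz) as H. fold A in H. pose proof (Cmod_ge_0 A).
apply Rmult_le_reg_r with (Cmod (clunie_den alpha b z)); [lra|].
unfold Rdiv. rewrite Rmult_assoc, Rinv_l; lra.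
Qed.

(** [omega_le_1] only gives |z g'| <= |z g' - alpha g|; the Schwarz lemma removes
    the factor z. *)
Lemma dg_le_clunie_den alpha b z : 0 < alpha -> derivative_in_G alpha b -> Cmod z < 1 ->
  Cmod (csum (cderiv_coef b) z) <= Cmod (clunie_den alpha b z).
Proof.
intros Hal Hb Hz.
assert (H := schwarz_lemma _ z (holo_clunie_quot alpha b Hal Hb)
               (fun w => omega_le_1 alpha b w Hal Hb) Hz).
assert (H0 := clunie_den_neq_0 alpha b z Hal Hb Hz).
assert (Hd : 0 < Cmod (clunie_den alpha b z)) by (apply Cmod_gt_0, H0).
unfold clunie_quot in H. rewrite Cmod_mult, Cmod_inv in H by exact H0.
apply Rmult_le_compat_r with (r := Cmod (clunie_den alpha b z)) in H; [|lra].
rewrite Rmult_assoc, Rinv_l in H; lra.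
Qed.

Lemma ctrunc_z_deriv b n z :
  (z * ctrunc (cderiv_coef b) n z = ctrunc (fun k => INR k * b k) (S n) z)%C.
Proof.
induction n as [|n IH].
- rewrite ctrunc_S, !ctrunc_0. unfold cderiv_coef. simpl. ring.
- rewrite ctrunc_S, ctrunc_S, <- IH. unfold cderiv_coef. rewrite (Cpow_S z (S n)). ring.
Qed.

Lemma ctrunc_clunie_den (alpha : R) b n z :
  (ctrunc (fun k => (INR k - alpha) * b k) n z
   = ctrunc (fun k => INR k * b k) n z - alpha * ctrunc b n z)%C.
Proof.
induction n as [|n IH].
- rewrite !ctrunc_0. ring.
- rewrite !ctrunc_S, IH. ring.
Qed.

Lemma pow_ge_bernoulli (e : R) (m : nat) : 0 <= e <= 1 -> 1 - INR m * e <= (1 - e) ^ m.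
Proof.
intros He. induction m as [|m IH]; [simpl; lra|].
rewrite S_INR. simpl. pose proof (pos_INR m).
assert ((1 - e) * (1 - INR m * e) <= (1 - e) * (1 - e) ^ m)
  by (apply Rmult_le_compat_l; lra).
assert (0 <= INR m * e * e) by (repeat apply Rmult_le_pos; lra). lra.
Qed.

Lemma le_of_pow_le (x y : R) (m : nat) :
  0 <= x -> (forall r, 0 <= r < 1 -> x * r ^ m <= y) -> x <= y.
Proof.
intros Hx H. apply le_epsilon. intros eps Heps.
pose proof (pos_INR m) as Hm.
assert (Hxm : 0 <= x * INR m) by (apply Rmult_le_pos; assumption).
set (e := Rmin 1 (eps / (x * INR m + 1))).
assert (He : 0 < e) by (apply Rmin_pos; [lra | apply Rdiv_lt_0_compat; lra]).
assert (He1 : e <= 1) by apply Rmin_l.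
assert (He2 : e <= eps / (x * INR m + 1)) by apply Rmin_r.
apply Rmult_le_compat_r with (r := x * INR m + 1) in He2; [|lra].
unfold Rdiv in He2. rewrite Rmult_assoc, Rinv_l in He2 by lra.
specialize (H (1 - e) ltac:(lra)).
pose proof (pow_ge_bernoulli e m ltac:(lra)) as Hp.
apply Rmult_le_compat_l with (r := x) in Hp; [|exact Hx]. nra.
Qed.

Lemma sum_Sn_R (u : nat -> R) n : sum_n u (S n) = sum_n u n + u (S n).
Proof. exact (sum_Sn u n). Qed.

(** [clunie_truncation] for c_k = k b_k and d_k = (k - alpha) b_k.  For k >= 1,
    |d_k| <= |c_k| because 0 < alpha <= 1, so all terms cancel but |c_(n+1)| and
    |d_0| = alpha. *)
Lemma coefficient_bound alpha b n :
  0 < alpha <= 1 -> derivative_in_G alpha b -> INR (S n) * Cmod (b (S n)) <= alpha.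
Proof.
intros Hal Hb. assert (Hq := holo_clunie_quot alpha b (proj1 Hal) Hb).
assert (Hom1 := fun z => omega_le_1 alpha b z (proj1 Hal) Hb).
assert (Hnz := fun z => clunie_den_neq_0 alpha b z (proj1 Hal) Hb).
destruct Hb as [Hrad [Hb0 _]].
assert (Hrad' := abs_radius_deriv _ Hrad).
set (c := fun k => (INR k * b k)%C).
set (d := fun k => ((INR k - alpha) * b k)%C).
assert (Ec : forall k, Cmod (c k) = INR k * Cmod (b k)).
{ intros k. unfold c. rewrite Cmod_mult, Cmod_R, Rabs_pos_eq by apply pos_INR. reflexivity. }
assert (Hd0 : Cmod (d 0%nat) = alpha).
{ unfold d. rewrite Hb0, Cmult_1_r. simpl INR.
  rewrite <- RtoC_minus, Cmod_R, Rabs_left; lra. }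
assert (Hdc : forall k, Cmod (d (S k)) <= Cmod (c (S k))).
{ intros k. rewrite Ec. unfold d.
  rewrite Cmod_mult, <- RtoC_minus, Cmod_R.
  apply Rmult_le_compat_r; [apply Cmod_ge_0|].
  rewrite S_INR. pose proof (pos_INR k). rewrite Rabs_pos_eq; lra. }
rewrite <- Ec. apply (le_of_pow_le _ _ (S n)); [apply Cmod_ge_0|].
intros r Hr.
set (C1 := csum (fun k => cderiv_coef b (S n + k)%nat)).
set (C2 := csum (fun k => b (S n + k)%nat)).
set (phi := clunie_quot alpha b) in *.
set (dg := csum (cderiv_coef b)).
assert (HC1 : holo C1) by apply holo_csum, abs_radius_shift, Hrad'.
assert (HC2 : holo C2) by apply holo_csum, abs_radius_shift, Hrad.
(* z g' - alpha g = ctrunc d n + z^(n+1) E1, while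
   z g' = ctrunc c (n+1) + z^(n+2) C1. *)
set (E1 := fun z => (c (S n) + (z * C1 z + - alpha * C2 z))%C).
assert (HE1 : holo E1).
{ apply holo_plus; [apply holo_const|]. apply holo_plus; apply holo_mult;
    try assumption; [apply holo_id | apply holo_const]. }
assert (HPsi : holo (fun z => C1 z + - (1) * (phi z * E1 z))%C).
{ apply holo_plus; [exact HC1|]. apply holo_mult; [apply holo_const|].
  apply holo_mult; [exact Hq | exact HE1]. }
assert (Hom : holo (fun z => z * phi z)%C).
{ apply holo_mult; [apply holo_id | exact Hq]. }
assert (HT := clunie_truncation c d _ _ r n Hom Hom1 HPsi).
assert (Hle : sum_n (fun k => (Cmod (c k) * r ^ k) ^ 2) (S n)
  <= sum_n (fun k => (Cmod (d k) * r ^ k) ^ 2) n).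
{ apply HT; [|exact Hr]. intros z Hz.
  assert (EA : (z * dg z = ctrunc c (S n) z + z ^ S (S n) * C1 z)%C).
  { unfold c. rewrite <- ctrunc_z_deriv. unfold dg.
    rewrite (csum_split _ n z Hrad' Hz). fold (C1 z). rewrite (Cpow_S z (S n)). ring. }
  assert (EB : (ctrunc d n z = clunie_den alpha b z - z ^ S n * E1 z)%C).
  { unfold clunie_den. fold dg. rewrite EA, (csum_split b n z Hrad Hz). fold (C2 z).
    unfold d. rewrite ctrunc_clunie_den. fold c. rewrite ctrunc_S. unfold E1.
    rewrite (Cpow_S z (S n)). ring. }
  rewrite EB. unfold phi, clunie_quot. fold dg.
  transitivity (z * dg z - z * (dg z * / clunie_den alpha b z) * (z ^ S n * E1 z))%C.
  - rewrite EA at 1. rewrite (Cpow_S z (S n)). ring.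
  - field. apply Hnz, Hz. }
assert (Hcmp : sum_n (fun k => (Cmod (d k) * r ^ k) ^ 2) n
  <= alpha ^ 2 + sum_n (fun k => (Cmod (c k) * r ^ k) ^ 2) n).
{ clear - Hd0 Hdc Hr. induction n as [|n IH].
  - rewrite !sum_O. rewrite Hd0. pose proof (pow2_ge_0 (Cmod (c 0%nat) * r ^ 0)). simpl in *. lra.
  - rewrite !sum_Sn_R.
    assert ((Cmod (d (S n)) * r ^ S n) ^ 2 <= (Cmod (c (S n)) * r ^ S n) ^ 2).
    { assert (0 <= r ^ S n) by (apply pow_le, Hr).
      apply pow_incr. split.
      - apply Rmult_le_pos; [apply Cmod_ge_0 | assumption].
      - apply Rmult_le_compat_r; [assumption | apply Hdc]. }
    lra. }
rewrite sum_Sn_R in Hle.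
assert (Hsq : (Cmod (c (S n)) * r ^ S n) ^ 2 <= alpha ^ 2) by lra.
assert (0 <= Cmod (c (S n)) * r ^ S n).
{ apply Rmult_le_pos; [apply Cmod_ge_0 | apply pow_le, Hr]. }
nra.
Qed.

(** * Logarithms of solutions of a linear equation *)

Lemma exp_neg_le_quadratic (d : R) : 0 <= d -> exp (- d) <= 1 - d + d ^ 2 / 2.
Proof.
intros [Hd | <-]; [|rewrite Ropp_0, exp_0; lra].
destruct (MVT_cor2 (fun x => 1 - x + x ^ 2 / 2 - exp (- x))
            (fun x => - 1 + x + exp (- x)) 0 d Hd) as [c [Hc Hcd]].
- intros c _. apply is_derive_Reals. auto_derive; [exact I | field].
- rewrite Ropp_0, exp_0 in Hc. pose proof (exp_ineq1_le (- c)).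
  assert (0 <= (- 1 + c + exp (- c)) * (d - 0)) by (apply Rmult_le_pos; lra). lra.
Qed.

Lemma cos_ge_quadratic (y : R) : 1 - y ^ 2 / 2 <= cos y.
Proof.
replace y with (2 * (y / 2)) at 2 by field. rewrite cos_2a_sin.
set (u := y / 2). replace (y ^ 2) with (4 * u ^ 2) by (unfold u; field).
assert (H : forall v, 0 < v -> sin v ^ 2 <= v ^ 2).
{ intros v Hv. pose proof (sin_lt_x v Hv). pose proof (SIN_bound v).
  destruct (Rle_lt_dec 1 v); [nra|].
  assert (0 < sin v) by (apply sin_gt_0; [exact Hv | pose proof PI2_1; lra]). nra. }
assert (Hu : sin u ^ 2 <= u ^ 2).
{ destruct (Rtotal_order u 0) as [Hn | [-> | Hp]].
  - specialize (H (- u) ltac:(lra)). rewrite sin_neg in H. lra.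
  - rewrite sin_0. lra.
  - apply H, Hp. }
lra.
Qed.

(** With d = a + X the constraint gives y^2 <= d (2a - d) <= d (2 - d), hence
    cos y >= 1 - y^2 / 2 >= 1 - d + d^2 / 2 >= exp (- d).  The bound a <= 1 is
    the range in which exp maps centred disks to convex sets. *)
Lemma exp_disk_Re_ge (X y a : R) :
  0 <= a <= 1 -> X ^ 2 + y ^ 2 <= a ^ 2 -> exp (- a) <= exp X * cos y.
Proof.
intros Ha H.
assert (HX : - a <= X <= a) by (split; nra).
replace (- a) with (X + - (a + X)) by ring. rewrite exp_plus.
apply Rmult_le_compat_l; [apply Rlt_le, exp_pos|].
apply Rle_trans with (1 := exp_neg_le_quadratic (a + X) ltac:(lra)).
apply Rle_trans with (2 := cos_ge_quadratic y). nra.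
Qed.

(** For G' = Q G with G = u + i v and Q = q1 + i q2, the function
    G exp (- (x + i y)) is constant; no branch of the logarithm of G is chosen. *)
Lemma linear_ode_polar (u v x y q1 q2 : R -> R) :
  (forall t, 0 <= t <= 1 -> is_derive u t (q1 t * u t - q2 t * v t)) ->
  (forall t, 0 <= t <= 1 -> is_derive v t (q1 t * v t + q2 t * u t)) ->
  (forall t, 0 <= t <= 1 -> is_derive x t (q1 t)) ->
  (forall t, 0 <= t <= 1 -> is_derive y t (q2 t)) ->
  u 0 = 1 -> v 0 = 0 -> x 0 = 0 -> y 0 = 0 -> u 1 = exp (x 1) * cos (y 1).
Proof.
intros Hu Hv Hx Hy u0 v0 x0 y0.
assert (E1 : exp (- x 0) * (u 0 * cos (y 0) + v 0 * sin (y 0))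
           = exp (- x 1) * (u 1 * cos (y 1) + v 1 * sin (y 1))).
{ apply (eq_is_derive (fun t => exp (- x t) * (u t * cos (y t) + v t * sin (y t))));
    [|lra]. intros t Ht.
  specialize (Hu t Ht). specialize (Hv t Ht). specialize (Hx t Ht). specialize (Hy t Ht).
  auto_derive.
  - repeat split; eexists; eassumption.
  - rewrite (is_derive_unique (fun t : R => u t) _ _ Hu),
      (is_derive_unique (fun t : R => v t) _ _ Hv),
      (is_derive_unique (fun t : R => x t) _ _ Hx),
      (is_derive_unique (fun t : R => y t) _ _ Hy).
    unfold zero; simpl. ring. }
assert (E2 : exp (- x 0) * (v 0 * cos (y 0) - u 0 * sin (y 0))
           = exp (- x 1) * (v 1 * cos (y 1) - u 1 * sin (y 1))).
{ apply (eq_is_derive (fun t => exp (- x t) * (v t * cos (y t) - u t * sin (y t))));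
    [|lra]. intros t Ht.
  specialize (Hu t Ht). specialize (Hv t Ht). specialize (Hx t Ht). specialize (Hy t Ht).
  auto_derive.
  - repeat split; eexists; eassumption.
  - rewrite (is_derive_unique (fun t : R => u t) _ _ Hu),
      (is_derive_unique (fun t : R => v t) _ _ Hv),
      (is_derive_unique (fun t : R => x t) _ _ Hx),
      (is_derive_unique (fun t : R => y t) _ _ Hy).
    unfold zero; simpl. ring. }
rewrite u0, v0, x0, y0, cos_0, sin_0, Ropp_0, exp_0 in E1, E2.
assert (He : exp (x 1) * exp (- x 1) = 1) by (rewrite <- exp_plus, Rplus_opp_r; apply exp_0).
pose proof (sin2_cos2 (y 1)) as Hsc. unfold Rsqr in Hsc.
set (e := exp (- x 1)) in *.
transitivity (exp (x 1) * e * u 1 * (sin (y 1) * sin (y 1) + cos (y 1) * cos (y 1))).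
{ rewrite He, Hsc. ring. }
replace (exp (x 1) * cos (y 1)) with (exp (x 1) * (cos (y 1) * (1 * (1 * 1 + 0 * 0))
   - sin (y 1) * (1 * (0 * 1 - 1 * 0)))) by ring.
rewrite E1, E2. ring.
Qed.

(** A velocity in a disk of moving centre c' and radius a' keeps the point in the
    disk of centre c and radius a: project on the final displacement and use
    the Cauchy-Schwarz inequality. *)
Lemma integral_in_disk (x y q1 q2 c c' a a' : R -> R) :
  (forall t, 0 <= t <= 1 -> is_derive x t (q1 t)) ->
  (forall t, 0 <= t <= 1 -> is_derive y t (q2 t)) ->
  (forall t, 0 <= t <= 1 -> is_derive c t (c' t)) ->
  (forall t, 0 <= t <= 1 -> is_derive a t (a' t)) ->
  x 0 = 0 -> y 0 = 0 -> c 0 = 0 -> a 0 = 0 ->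
  (forall t, 0 <= t <= 1 -> 0 <= a' t /\ (q1 t - c' t) ^ 2 + q2 t ^ 2 <= a' t ^ 2) ->
  (x 1 - c 1) ^ 2 + y 1 ^ 2 <= a 1 ^ 2.
Proof.
intros Hx Hy Hc Ha x0 y0 c0 a0 HQ.
set (X := x 1 - c 1). set (Y := y 1). set (N := sqrt (X ^ 2 + Y ^ 2)).
assert (HN2 : N ^ 2 = X ^ 2 + Y ^ 2).
{ unfold N. rewrite <- Rsqr_pow2. apply Rsqr_sqrt. nra. }
assert (HN : 0 <= N) by apply sqrt_pos.
destruct (MVT_cor2 (fun t => N * a t - X * (x t - c t) - Y * y t)
   (fun t => N * a' t - X * (q1 t - c' t) - Y * q2 t) 0 1 Rlt_0_1) as [t [Ht Ht01]].
{ intros t Ht. apply is_derive_Reals.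
  specialize (Hx t Ht). specialize (Hy t Ht). specialize (Hc t Ht). specialize (Ha t Ht).
  auto_derive.
  - repeat split; eexists; eassumption.
  - rewrite (is_derive_unique (fun t : R => x t) _ _ Hx),
      (is_derive_unique (fun t : R => y t) _ _ Hy),
      (is_derive_unique (fun t : R => c t) _ _ Hc),
      (is_derive_unique (fun t : R => a t) _ _ Ha). ring. }
rewrite x0, y0, c0, a0 in Ht. fold X Y in Ht.
destruct (HQ t ltac:(lra)) as [Hp Hq].
set (p := q1 t - c' t) in *. set (q := q2 t) in *. set (s := a' t) in *.
assert (HCS : (X * p + Y * q) ^ 2 <= (N * s) ^ 2).
{ apply Rle_trans with (N ^ 2 * (p ^ 2 + q ^ 2)).
  - rewrite HN2. pose proof (pow2_ge_0 (X * q - Y * p)). nra.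
  - rewrite Rpow_mult_distr. apply Rmult_le_compat_l; [apply pow2_ge_0 | exact Hq]. }
assert (HNs : 0 <= N * s) by (apply Rmult_le_pos; assumption).
assert (X * p + Y * q <= N * s) by nra.
assert (HNa : N ^ 2 <= N * a 1) by nra.
rewrite <- HN2. destruct HN as [HN | HN].
- assert (N <= a 1) by nra. nra.
- rewrite <- HN. pose proof (pow2_ge_0 (a 1)). nra.
Qed.

(** The inequality |p| <= r |t p - alpha| describes a disk in p (Apollonius);
    this is its centre and radius. *)
Lemma log_deriv_disk (alpha s t r p1 p2 : R) :
  0 < alpha -> 0 <= t <= 1 -> 0 <= r < 1 ->
  p1 ^ 2 + p2 ^ 2 <= r ^ 2 * ((t * p1 - alpha) ^ 2 + (t * p2) ^ 2) ->
  s = 1 - (r * t) ^ 2 ->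
  (p1 - - (alpha * r ^ 2 * t / s)) ^ 2 + p2 ^ 2 <= (alpha * r / s) ^ 2.
Proof.
intros Ha Ht Hr H Hs.
assert (Hrt : 0 <= r * t < 1) by (split; nra).
assert (Hs0 : 0 < s) by (rewrite Hs; nra).
assert (E : (alpha * r / s) ^ 2 - (p1 - - (alpha * r ^ 2 * t / s)) ^ 2 - p2 ^ 2
  = (r ^ 2 * ((t * p1 - alpha) ^ 2 + (t * p2) ^ 2) - (p1 ^ 2 + p2 ^ 2)) / s).
{ assert (Hr2 : (r * t) ^ 2 = 1 - s) by lra.
  field_simplify_eq; [|lra].
  replace s with (1 - (r * t) ^ 2). ring. }
assert (0 <= (r ^ 2 * ((t * p1 - alpha) ^ 2 + (t * p2) ^ 2) - (p1 ^ 2 + p2 ^ 2)) / s).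
{ apply Rmult_le_pos; [lra | apply Rlt_le, Rinv_0_lt_compat, Hs0]. }
lra.
Qed.

(** * The distortion bound *)

Lemma is_derive_RInt_0 (q : R -> R) (T : R) :
  1 < T -> (forall s, Rabs s < T -> continuous q s) ->
  forall t, 0 <= t <= 1 -> is_derive (fun s => RInt q 0 s) t (q t).
Proof.
intros HT Hq t Ht. apply (is_derive_RInt q (fun s => RInt q 0 s) 0 t).
- assert (Hd : 0 < T - 1) by lra.
  exists (mkposreal _ Hd). intros s Hs. change (Rabs (s - t) < T - 1) in Hs.
  apply (@RInt_correct R_CompleteNormedModule).
  apply (@ex_RInt_continuous R_CompleteNormedModule). intros w Hw. apply Hq.
  assert (Rabs s < T).
  { pose proof (Rabs_triang_inv s t) as H. rewrite (Rabs_pos_eq t) in H by lra. lra. }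
  apply Rabs_def2 in H. revert Hw. unfold Rmin, Rmax.
  destruct (Rle_dec 0 s); intros Hw; apply Rabs_def1; lra.
- apply Hq. rewrite Rabs_pos_eq; lra.
Qed.

(** Integrate g' / g along t -> t z.  At t, [dg_le_clunie_den] confines the velocity
    to the disk of centre c'(t) and radius a'(t), where c - a = alpha ln (1 - r t). *)
Lemma distortion (alpha : R) (b : nat -> C) (z : C) :
  0 < alpha -> derivative_in_G alpha b -> Cmod z < 1 ->
  alpha / 2 * (ln (1 + Cmod z) - ln (1 - Cmod z)) <= 1 ->
  Rpower (1 - Cmod z) alpha <= Re (csum b z).
Proof.
intros Hal Hb Hz Ha1. set (r := Cmod z) in *.
assert (Hr : 0 <= r < 1) by (split; [apply Cmod_ge_0 | exact Hz]).
assert (Hrad := proj1 Hb). assert (Hrad' := abs_radius_deriv _ Hrad).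
assert (Hnz : forall w, Cmod w < 1 -> csum b w <> 0) by (intros w Hw; apply Hb, Hw).
set (p := fun t : R => (t * Re z, t * Im z) : C).
assert (Ep : forall t, p t = (t * z)%C).
{ intros t. unfold p. destruct z as [z1 z2]. unfold Re, Im, RtoC, Cmult; simpl.
  f_equal; ring. }
(* The curve t -> t z stays in the disk a little beyond [0, 1], as (2 - r) r < 1. *)
assert (Hp : forall t, Rabs t < 2 - r -> Cmod (p t) < 1).
{ intros t Ht. rewrite Ep, Cmod_mult, Cmod_R. fold r.
  pose proof (Rabs_pos t). nra. }
assert (Hp01 : forall t, 0 <= t <= 1 -> Cmod (p t) < 1).
{ intros t Ht. apply Hp. rewrite Rabs_pos_eq; lra. }
assert (Hcurve : forall F d t, cdiff F (p t) d ->
  is_derive (fun s => Re (F (p s))) t (Re (d * z)) /\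
  is_derive (fun s => Im (F (p s))) t (Im (d * z))).
{ intros F d t HF.
  assert (Ed : (d * z = d * (Re z, Im z))%C) by (f_equal; apply surjective_pairing).
  rewrite Ed.
  apply (cdiff_along_curve F (fun s => s * Re z) (fun s => s * Im z)); [exact HF| |].
  - auto_derive; [exact I | unfold Re; ring].
  - auto_derive; [exact I | unfold Im; ring]. }
set (Q := fun w => (z * (csum (cderiv_coef b) w * / csum b w))%C).
assert (HQ : holo Q).
{ apply holo_mult; [apply holo_const|]. apply holo_mult; [apply holo_csum, Hrad'|].
  apply holo_inv; [apply holo_csum, Hrad | exact Hnz]. }
set (q1 := fun t => Re (Q (p t))). set (q2 := fun t => Im (Q (p t))).
assert (Hcont : forall s, Rabs s < 2 - r -> continuous q1 s /\ continuous q2 s).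
{ intros s Hs. destruct HQ as [dQ HdQ].
  destruct (Hcurve Q (dQ (p s)) s) as [H1 H2]; [apply HdQ, Hp, Hs|].
  split; apply (@ex_derive_continuous R_AbsRing R_NormedModule).
  - eexists; exact H1.
  - eexists; exact H2. }
assert (Hx := is_derive_RInt_0 q1 (2 - r) ltac:(lra) (fun s Hs => proj1 (Hcont s Hs))).
assert (Hy := is_derive_RInt_0 q2 (2 - r) ltac:(lra) (fun s Hs => proj2 (Hcont s Hs))).
set (x := fun s => RInt q1 0 s) in *. set (y := fun s => RInt q2 0 s) in *.
assert (x0 : x 0 = 0) by apply (@RInt_point R_CompleteNormedModule).
assert (y0 : y 0 = 0) by apply (@RInt_point R_CompleteNormedModule).
assert (Hg0 : csum b (p 0) = RtoC 1).
{ rewrite (csum_split b 0 _ Hrad) by (apply Hp01; lra).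
  rewrite ctrunc_0, (proj1 (proj2 Hb)), Ep. simpl. ring. }
assert (Hg1 : p 1 = z) by (rewrite Ep; ring).
assert (Hpolar : Re (csum b (p 1)) = exp (x 1) * cos (y 1)).
{ assert (EQ : forall t, 0 <= t <= 1 ->
    (csum (cderiv_coef b) (p t) * z = Q (p t) * csum b (p t))%C).
  { intros t Ht. unfold Q. field. apply Hnz, Hp01, Ht. }
  apply (linear_ode_polar (fun t => Re (csum b (p t))) (fun t => Im (csum b (p t)))
           x y q1 q2); try assumption.
  - intros t Ht.
    destruct (Hcurve _ _ t (csum_cdiff b (p t) Hrad (Hp01 t Ht))) as [H _].
    rewrite EQ, re_mult in H by exact Ht. exact H.
  - intros t Ht.
    destruct (Hcurve _ _ t (csum_cdiff b (p t) Hrad (Hp01 t Ht))) as [_ H].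
    rewrite EQ, im_mult in H by exact Ht. exact H.
  - rewrite Hg0. reflexivity.
  - rewrite Hg0. reflexivity. }
rewrite Hg1 in Hpolar.
set (c := fun t => alpha / 2 * (ln (1 + r * t) + ln (1 - r * t))).
set (a := fun t => alpha / 2 * (ln (1 + r * t) - ln (1 - r * t))).
assert (Hrt : forall t, 0 <= t <= 1 -> 0 <= r * t < 1) by (intros t Ht; split; nra).
assert (Hdisk : (x 1 - c 1) ^ 2 + y 1 ^ 2 <= a 1 ^ 2).
{ apply (integral_in_disk x y q1 q2 c (fun t => - (alpha * r ^ 2 * t / (1 - (r * t) ^ 2)))
           a (fun t => alpha * r / (1 - (r * t) ^ 2))); try assumption.
  - intros t Ht. specialize (Hrt t Ht). unfold c. auto_derive; [lra|].
    assert (0 < 1 - (r * t) ^ 2) by nra.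
    field. repeat split; apply Rgt_not_eq; nra.
  - intros t Ht. specialize (Hrt t Ht). unfold a. auto_derive; [lra|].
    assert (0 < 1 - (r * t) ^ 2) by nra.
    field. repeat split; apply Rgt_not_eq; nra.
  - unfold c. rewrite Rmult_0_r, Rplus_0_r, Rminus_0_r, ln_1. ring.
  - unfold a. rewrite Rmult_0_r, Rplus_0_r, Rminus_0_r, ln_1. ring.
  - intros t Ht. specialize (Hrt t Ht). split.
    { apply Rmult_le_pos; [nra|]. apply Rlt_le, Rinv_0_lt_compat. nra. }
    apply (log_deriv_disk alpha _ t r); try assumption; [|reflexivity].
    assert (Hw := Hp01 t Ht). assert (Hgw := Hnz _ Hw).
    assert (Hd := dg_le_clunie_den alpha b _ Hal Hb Hw). unfold clunie_den in Hd.
    set (w := p t) in *. set (g := csum b w) in *. set (dg := csum (cderiv_coef b) w) in *.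
    assert (Hgm : 0 < Cmod g) by (apply Cmod_gt_0, Hgw).
    assert (EQ : Q w = (z * (dg * / g))%C) by reflexivity.
    assert (H1 : Cmod (Q w) * Cmod g = r * Cmod dg).
    { rewrite EQ, !Cmod_mult, Cmod_inv by exact Hgw. fold r. field. lra. }
    assert (H2 : Cmod (w * dg + - alpha * g) = Cmod (t * Q w - alpha) * Cmod g).
    { rewrite <- Cmod_mult. f_equal. rewrite EQ. unfold w. rewrite Ep. field. exact Hgw. }
    assert (H3 : Cmod (Q w) <= r * Cmod (t * Q w - alpha)).
    { apply Rmult_le_reg_r with (Cmod g); [exact Hgm|].
      rewrite H1, Rmult_assoc, <- H2. apply Rmult_le_compat_l; [lra | exact Hd]. }
    assert (H4 : Cmod (Q w) ^ 2 <= (r * Cmod (t * Q w - alpha)) ^ 2).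
    { apply pow_incr. split; [apply Cmod_ge_0 | exact H3]. }
    rewrite Rpow_mult_distr, !Cmod2_alt in H4. fold (q1 t) (q2 t) in H4.
    replace (Re (t * Q w - alpha)) with (t * q1 t - alpha) in H4
      by (unfold q1; fold w; unfold Re; simpl; ring).
    replace (Im (t * Q w - alpha)) with (t * q2 t) in H4
      by (unfold q2; fold w; unfold Im; simpl; ring).
    unfold q1, q2 in *; fold w in H4 |- *. exact H4. }
assert (Hc1 : c 1 = alpha / 2 * (ln (1 + r) + ln (1 - r)))
  by (unfold c; rewrite Rmult_1_r; reflexivity).
assert (Ha1' : a 1 = alpha / 2 * (ln (1 + r) - ln (1 - r)))
  by (unfold a; rewrite Rmult_1_r; reflexivity).
assert (Ha0 : 0 <= a 1).
{ rewrite Ha1'. apply Rmult_le_pos; [lra|].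
  destruct (Req_dec r 0) as [-> | Hr0].
  - rewrite Rplus_0_r, Rminus_0_r. lra.
  - pose proof (ln_increasing (1 - r) (1 + r) ltac:(lra) ltac:(lra)). lra. }
assert (Hfin := exp_disk_Re_ge (x 1 - c 1) (y 1) (a 1) ltac:(lra) Hdisk).
rewrite Hpolar. replace (x 1) with (c 1 + (x 1 - c 1)) by ring.
rewrite exp_plus, Rmult_assoc.
apply Rle_trans with (exp (c 1) * exp (- a 1)).
- rewrite <- exp_plus. unfold Rpower. apply Req_le. f_equal. rewrite Hc1, Ha1'. field.
- apply Rmult_le_compat_l; [apply Rlt_le, exp_pos | exact Hfin].
Qed.

(** * The function K and the sections *)

(** The difference of the two sides vanishes at 0 and has the nonnegative
    derivative 1 / (1 - x) - 1 - (x + ... + x^(N+1)). *)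
Lemma log_tail (r : R) (N : nat) : 0 <= r < 1 ->
  sum_n (fun k => r ^ (k + 2) / INR (k + 2)) N <= - ln (1 - r) - r.
Proof.
intros Hr.
assert (HD : forall x, is_derive (fun y => sum_n (fun k => y ^ (k + 2) / INR (k + 2)) N) x
   (sum_n (fun k => x ^ (k + 1)) N)).
{ intros x.
  apply (@is_derive_sum_n R_AbsRing R_NormedModule
    (fun k y => y ^ (k + 2) / INR (k + 2)) N x (fun k => x ^ (k + 1))).
  intros k _. auto_derive; [exact I|].
  rewrite Nat.add_succ_r, (Nat.add_succ_r k 0), Nat.add_0_r.
  change (Init.Nat.pred (S (S k))) with (S k). field. apply not_0_INR. lia. }
assert (Hgeo : forall x, (1 - x) * sum_n (fun k => x ^ (k + 1)) N = x - x ^ (N + 2)).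
{ clear. intros x. induction N as [|n IH].
  - rewrite sum_O. simpl. ring.
  - rewrite sum_Sn_R, Rmult_plus_distr_l, IH, !pow_add. simpl. ring. }
assert (E0 : sum_n (fun k => 0 ^ (k + 2) / INR (k + 2)) N = 0).
{ transitivity (sum_n (fun _ : nat => 0) N).
  - apply sum_n_ext. intros k. rewrite Nat.add_succ_r. simpl. unfold Rdiv. ring.
  - rewrite sum_n_const. apply Rmult_0_r. }
destruct (proj1 Hr) as [Hr0 | <-].
2:{ rewrite E0, !Rminus_0_r, ln_1. lra. }
destruct (MVT_cor2
  (fun x => - ln (1 - x) - x - sum_n (fun k => x ^ (k + 2) / INR (k + 2)) N)
  (fun x => / (1 - x) - 1 - sum_n (fun k => x ^ (k + 1)) N) 0 r Hr0) as [c [Hc Hc']].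
- intros x Hx. apply is_derive_Reals.
  apply (is_derive_minus (fun x => - ln (1 - x) - x)); [|apply HD].
  auto_derive; [lra|]. field. lra.
- rewrite E0, !Rminus_0_r, ln_1 in Hc.
  assert (0 <= / (1 - c) - 1 - sum_n (fun k => c ^ (k + 1)) N).
  { apply Rmult_le_reg_l with (1 - c); [lra|].
    rewrite !Rmult_minus_distr_l, Hgeo, Rinv_r by lra.
    assert (0 <= c ^ (N + 2)) by (apply pow_le; lra). lra. }
  assert (0 <= (/ (1 - c) - 1 - sum_n (fun k => c ^ (k + 1)) N) * r)
    by (apply Rmult_le_pos; lra).
  lra.
Qed.

Lemma K_decreasing (alpha beta x y : R) :
  0 < alpha -> 0 <= x -> x < y < 1 -> K alpha beta y < K alpha beta x.
Proof.
intros Ha Hx Hxy. unfold K.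
assert (H1 : Rpower (1 - y) alpha < Rpower (1 - x) alpha).
{ unfold Rpower. apply exp_increasing, Rmult_lt_compat_l; [exact Ha|].
  apply ln_increasing; lra. }
assert (H2 : ln (1 - y) + y <= ln (1 - x) + x).
{ assert (Hq : 0 < (1 - y) / (1 - x)) by (apply Rdiv_lt_0_compat; lra).
  pose proof (exp_ineq1_le (ln ((1 - y) / (1 - x)))) as H.
  rewrite exp_ln in H by exact Hq. rewrite ln_div in H by lra.
  assert ((1 - y) / (1 - x) <= 1 + x - y).
  { apply Rmult_le_reg_r with (1 - x); [lra|]. unfold Rdiv.
    rewrite Rmult_assoc, Rinv_l by lra. nra. }
  lra. }
apply Rmult_le_compat_l with (r := alpha) in H2; lra.
Qed.

Lemma K_at_0 (alpha beta : R) : K alpha beta 0 = 1 - beta.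
Proof.
unfold K, Rpower. rewrite Rminus_0_r, ln_1, Rmult_0_r, exp_0. ring.
Qed.

(** At x1 = 1 - exp (- 2 / alpha), K is at most exp (- 2) - 2 + alpha < 0. *)
Lemma K_root (alpha beta : R) : 0 < alpha <= 1 -> 0 <= beta < 1 ->
  exists rho, is_least_positive_root (K alpha beta) rho /\
    forall x, 0 <= x < rho -> 0 < K alpha beta x.
Proof.
(* chosen so that alpha ln (1 - x1) = - 2 *)
intros Ha Hbe. set (x1 := 1 - exp (- (2 / alpha))).
assert (Hq : 0 < 2 / alpha) by (apply Rdiv_lt_0_compat; lra).
assert (Hx1 : 0 < x1 < 1).
{ unfold x1. pose proof (exp_pos (- (2 / alpha))).
  assert (exp (- (2 / alpha)) < 1) by (rewrite <- exp_0; apply exp_increasing; lra). lra. }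
assert (HK1 : K alpha beta x1 < 0).
{ unfold K. replace (ln (1 - x1)) with (- (2 / alpha)).
  2:{ unfold x1. rewrite <- (ln_exp (- (2 / alpha))) at 1. f_equal. ring. }
  replace (Rpower (1 - x1) alpha) with (exp (- 2)).
  2:{ unfold Rpower. f_equal. replace (1 - x1) with (exp (- (2 / alpha))) by (unfold x1; ring).
      rewrite ln_exp. field. lra. }
  rewrite Rmult_plus_distr_l. replace (alpha * - (2 / alpha)) with (- 2) by (field; lra).
  assert (exp (- 2) < 1) by (rewrite <- exp_0; apply exp_increasing; lra). nra. }
destruct (IVT_interv (fun x => - K alpha beta x) 0 x1) as [rho [Hrho HK]].
- intros x Hx. apply derivable_continuous_pt, ex_derive_Reals_0.
  unfold K, Rpower. auto_derive. lra.
- apply Hx1.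
- rewrite K_at_0. lra.
- lra.
- assert (HK0 : K alpha beta rho = 0) by lra.
  assert (Hr0 : 0 < rho).
  { destruct (proj1 Hrho) as [H | H]; [exact H|]. rewrite <- H, K_at_0 in HK0. lra. }
  assert (Hpos : forall x, 0 <= x < rho -> 0 < K alpha beta x).
  { intros x Hx. rewrite <- HK0. apply K_decreasing; lra. }
  exists rho. split; [|exact Hpos].
  split; [lra | split; [exact HK0|]]. intros x Hx HKx.
  apply Rnot_lt_le. intros Hlt. specialize (Hpos x ltac:(lra)). lra.
Qed.

Lemma exp_pow4 (x : R) : exp x ^ 4 = exp (4 * x).
Proof.
replace (4 * x) with (x + (x + (x + x))) by ring. rewrite !exp_plus. ring.
Qed.

(** With s = - alpha ln (1 - r), positivity of K gives s < exp (- s) + 1, hence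
    s <= 1.3; together with ln 2 <= 0.7 the radius is at most (1.3 + 0.7) / 2. *)
Lemma K_pos_log_disk_radius (alpha beta r : R) :
  0 < alpha <= 1 -> 0 <= beta -> 0 <= r < 1 -> 0 < K alpha beta r ->
  alpha / 2 * (ln (1 + r) - ln (1 - r)) <= 1.
Proof.
intros Ha Hbe Hr HK. unfold K, Rpower in HK.
set (s := - (alpha * ln (1 - r))).
assert (Es : alpha * ln (1 - r) = - s) by (unfold s; ring).
rewrite Rmult_plus_distr_l, Es in HK.
assert (Hs : s <= 13 / 10).
{ apply Rnot_lt_le. intros Hs.
  assert (H1 : exp (- s) <= exp (- (13 / 40)) ^ 4).
  { rewrite exp_pow4. apply Rlt_le, exp_increasing. lra. }
  pose proof (exp_neg_le_quadratic (13 / 40) ltac:(lra)) as H2.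
  pose proof (exp_pos (- (13 / 40))).
  (* The quadratic bound of exp is too weak at 13/10, but not at a quarter of it. *)
  assert (H3 : exp (- (13 / 40)) ^ 4 <= (73 / 100) ^ 4) by (apply pow_incr; lra). nra. }
assert (Hl : ln (1 + r) <= 7 / 10).
{ rewrite <- (ln_exp (7 / 10)). apply ln_le; [lra|].
  assert (H1 : exp (- (7 / 40)) ^ 4 <= (8404 / 10000) ^ 4).
  { pose proof (exp_neg_le_quadratic (7 / 40) ltac:(lra)).
    pose proof (exp_pos (- (7 / 40))). apply pow_incr. lra. }
  rewrite exp_pow4 in H1.
  replace (4 * - (7 / 40)) with (- (7 / 10)) in H1 by field.
  assert (H2 : exp (7 / 10) * exp (- (7 / 10)) = 1)
    by (rewrite <- exp_plus, Rplus_opp_r; apply exp_0).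
  pose proof (exp_pos (7 / 10)).
  assert (exp (- (7 / 10)) <= / 2) by lra. nra. }
assert (H0 : 0 <= ln (1 + r)).
{ rewrite <- ln_1. apply ln_le; lra. }
assert (alpha * ln (1 + r) <= 7 / 10) by nra.
replace (alpha / 2 * (ln (1 + r) - ln (1 - r)))
  with ((alpha * ln (1 + r) - alpha * ln (1 - r)) / 2) by field.
lra.
Qed.

Lemma cdiff_pow (n : nat) (z : C) :
  cdiff (fun w => w ^ S n)%C z (INR (S n) * z ^ n)%C.
Proof.
induction n as [|n IH].
- replace (INR 1 * z ^ 0)%C with (1 * (RtoC 1) + z * 0)%C by (simpl; ring).
  exact (cdiff_mult (fun w => w) (fun _ => RtoC 1) z _ _ (cdiff_id z) (cdiff_const _ z)).
- replace (INR (S (S n)) * z ^ S n)%C with (1 * z ^ S n + z * (INR (S n) * z ^ n))%C.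
  + exact (cdiff_mult (fun w => w) (fun w => w ^ S n)%C z _ _ (cdiff_id z) IH).
  + rewrite (S_INR (S n)), RtoC_plus, Cpow_S. ring.
Qed.

Lemma cdiff_ctrunc (a : nat -> C) (n : nat) (z : C) :
  cdiff (ctrunc a (S n)) z (ctrunc (cderiv_coef a) n z).
Proof.
assert (Ext : forall F G d, (forall w, F w = G w) -> cdiff F z d -> cdiff G z d).
{ intros F G d E. apply (cdiff_ext_disk F G z d (Cmod z + 1)); [|lra].
  intros w _. apply E. }
assert (Hterm : forall k, cdiff (fun w => a (S k) * w ^ S k)%C z (cderiv_coef a k * z ^ k)%C).
{ intros k. unfold cderiv_coef.
  replace (INR (S k) * a (S k) * z ^ k)%C
    with (0 * z ^ S k + a (S k) * (INR (S k) * z ^ k))%C by ring.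
  apply (cdiff_mult (fun _ => a (S k)) (fun w => w ^ S k)%C);
    [apply cdiff_const | apply cdiff_pow]. }
induction n as [|n IH].
- apply (Ext (fun w => a 0%nat + a 1%nat * w ^ 1)%C).
  { intros w. rewrite ctrunc_S, ctrunc_0. reflexivity. }
  rewrite ctrunc_0.
  replace (cderiv_coef a 0) with (0 + cderiv_coef a 0 * z ^ 0)%C by (simpl; ring).
  apply (cdiff_plus (fun _ => a 0%nat)); [apply cdiff_const | apply (Hterm 0%nat)].
- apply (Ext (fun w => ctrunc a (S n) w + a (S (S n)) * w ^ S (S n))%C).
  { intros w. rewrite (ctrunc_S a (S n)). reflexivity. }
  rewrite ctrunc_S. apply cdiff_plus; [exact IH | apply Hterm].
Qed.

Lemma ctrunc_at_0 (b : nat -> C) (n : nat) : ctrunc b n 0 = b 0%nat.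
Proof.
induction n as [|n IH]; [apply ctrunc_0|]. rewrite ctrunc_S, IH, Cpow_S. ring.
Qed.

Lemma partial_section_ctrunc (a : nat -> C) (n : nat) (z : C) :
  a 0%nat = RtoC 0 -> a 1%nat = RtoC 1 ->
  partial_section a (S n) z = ctrunc a (S n) z.
Proof.
intros H0 H1. unfold partial_section, ctrunc. unfold sum_n.
rewrite (sum_n_m_Chasles _ 0 1 (S n)) by lia.
change (z + sum_n_m (fun k => a k * z ^ k)%C 2 (S n)
  = sum_n (fun k => a k * z ^ k)%C 1 + sum_n_m (fun k => a k * z ^ k)%C 2 (S n))%C.
f_equal. rewrite sum_Sn, sum_O. change (z = a 0%nat * z ^ 0 + a 1%nat * z ^ 1)%C.
rewrite H0, H1. simpl. ring.
Qed.

Lemma class_G_derivative (alpha : R) (f : C -> C) (a : nat -> C) :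
  class_G alpha f -> a 1%nat = RtoC 1 ->
  (forall z, Cmod z < 1 -> @is_pseries C_AbsRing C_NormedModule a z (f z)) ->
  derivative_in_G alpha (cderiv_coef a).
Proof.
intros [_ [Hnz HG]] Ha1 Hf.
assert (Hrad := abs_radius_of_pseries a f Hf).
assert (Hrad' := abs_radius_deriv _ Hrad).
assert (Df : forall z, Cmod z < 1 -> C_derive f z = csum (cderiv_coef a) z).
{ intros z Hz. apply C_derive_cdiff.
  apply (cdiff_ext_disk (csum a) f z _ 1); [|exact Hz|apply csum_cdiff; assumption].
  intros w Hw. apply csum_of_pseries; auto. }
assert (DDf : forall z, Cmod z < 1 ->
  C_derive (C_derive f) z = csum (cderiv_coef (cderiv_coef a)) z).
{ intros z Hz. apply C_derive_cdiff.
  apply (cdiff_ext_disk (csum (cderiv_coef a)) _ z _ 1);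
    [|exact Hz|apply csum_cdiff; assumption].
  intros w Hw. symmetry. apply Df, Hw. }
split; [exact Hrad' | split].
- unfold cderiv_coef. rewrite Ha1. simpl. ring.
- intros z Hz. specialize (Hnz z Hz). specialize (HG z Hz).
  unfold curvature in HG. rewrite Df in Hnz by exact Hz.
  rewrite Df, DDf, re_plus in HG by exact Hz. split; [exact Hnz|].
  simpl (Re 1) in HG. lra.
Qed.

(** Split g into truncation and tail.  Keeping degree at least 1 in the truncation
    makes the tail start at degree 2, which is where the sum in [log_tail] starts. *)
Lemma section_deriv_Re_gt (alpha beta : R) (b : nat -> C) (n : nat) (z : C) :
  0 < alpha <= 1 -> 0 <= beta -> derivative_in_G alpha b -> Cmod z < 1 ->
  0 < K alpha beta (Cmod z) -> beta < Re (ctrunc b (S n) z).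
Proof.
intros Ha Hbe Hb Hz HK. set (r := Cmod z) in *.
assert (Hr : 0 <= r < 1) by (split; [apply Cmod_ge_0 | exact Hz]).
assert (Hdist := distortion alpha b z (proj1 Ha) Hb Hz
                   (K_pos_log_disk_radius alpha beta r Ha Hbe Hr HK)). fold r in Hdist.
assert (Hrad := proj1 Hb).
assert (Htail : Cmod (z ^ S (S n) * csum (fun k => b (S (S n) + k)%nat) z)
                <= alpha * (- ln (1 - r) - r)).
{ assert (Hs := cseries_scal (z ^ S (S n)) _ _
    (csum_correct _ z (abs_radius_shift b (S (S n)) Hrad) Hz)).
  apply (cseries_Cmod_le _ _ _ Hs). intros N.
  apply Rle_trans with (sum_n (fun k => alpha * (r ^ (k + 2) / INR (k + 2))) N).
  - apply sum_n_Cmod_le. intros k. cbv beta.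
    rewrite !Cmod_mult, !Cmod_pow. fold r.
    assert (Hc := coefficient_bound alpha b (S n + k) Ha Hb).
    replace (S (S n) + k)%nat with (S (S n + k)) by lia.
    set (m := S (S n + k)) in *.
    assert (Hm2 : 0 < INR (k + 2)) by (apply lt_0_INR; lia).
    assert (Hmk : INR (k + 2) <= INR m) by (apply le_INR; unfold m; lia).
    pose proof (Cmod_ge_0 (b m)).
    replace (r ^ S (S n) * (Cmod (b m) * r ^ k)) with (Cmod (b m) * r ^ (S (S n) + k))
      by (rewrite pow_add; ring).
    replace (S (S n) + k)%nat with (n + (k + 2))%nat by lia. rewrite pow_add.
    assert (Hp : 0 <= r ^ (k + 2)) by (apply pow_le, Hr).
    assert (Hp1 : r ^ n <= 1).
    { rewrite <- (pow1 n). apply pow_incr. lra. }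
    apply Rle_trans with (Cmod (b m) * r ^ (k + 2)).
    + apply Rmult_le_compat_l; [assumption|].
      rewrite <- (Rmult_1_l (r ^ (k + 2))) at 2. apply Rmult_le_compat_r; assumption.
    + replace (alpha * (r ^ (k + 2) / INR (k + 2)))
        with (alpha / INR (k + 2) * r ^ (k + 2)) by (field; lra).
      apply Rmult_le_compat_r; [exact Hp|].
      apply Rmult_le_reg_r with (INR (k + 2)); [exact Hm2|].
      unfold Rdiv. rewrite Rmult_assoc, Rinv_l, Rmult_1_r by lra. nra.
  - apply Rle_trans with (1 := Req_le _ _ (@sum_n_mult_l R_Ring alpha _ N)).
    apply Rmult_le_compat_l; [lra|]. apply log_tail, Hr. }
rewrite (csum_split b (S n) z Hrad Hz), re_plus in Hdist.
pose proof (Rle_trans _ _ _ (Rle_trans _ _ _ (Rle_abs _) (re_le_Cmod _)) Htail).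
unfold K in HK. lra.
Qed.

Theorem theorem3p3 :
  forall alpha beta : R,
    0 < alpha <= 1 -> 0 <= beta < 1 ->
    exists rho : R,
      is_least_positive_root (K alpha beta) rho /\
      forall (f : C -> C) (a : nat -> C),
        class_G alpha f ->
        a 0%nat = RtoC 0 -> a 1%nat = RtoC 1 ->
        (forall z : C, Cmod z < 1 ->
           @is_pseries C_AbsRing C_NormedModule a z (f z)) ->
        forall n : nat, (2 <= n)%nat ->
          close_to_convex_in_disk beta (partial_section a n) rho.
Proof.
intros alpha beta Ha Hbe.
destruct (K_root alpha beta Ha Hbe) as [rho [Hroot Hpos]].
exists rho. split; [exact Hroot|].
intros f a HG Ha0 Ha1 Hf n Hn.
destruct n as [|[|n]]; [lia | lia |].
assert (Hb := class_G_derivative alpha f a HG Ha1 Hf).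
assert (Hd : forall z, cdiff (partial_section a (S (S n))) z
                         (ctrunc (cderiv_coef a) (S n) z)).
{ intros z. apply (cdiff_ext_disk (ctrunc a (S (S n))) _ z _ (Cmod z + 1)).
  - intros w _. symmetry. apply partial_section_ctrunc; assumption.
  - lra.
  - apply cdiff_ctrunc. }
assert (Did : forall z, C_derive (fun w => w) z = RtoC 1).
{ intros z. apply C_derive_cdiff, cdiff_id. }
assert (Dconst : forall z, C_derive (C_derive (fun w => w)) z = RtoC 0).
{ intros z. apply C_derive_cdiff.
  apply (cdiff_ext_disk (fun _ => RtoC 1) _ z _ (Cmod z + 1)); [|lra|apply cdiff_const].
  intros w _. symmetry. apply Did. }
split; [|split].
- intros z _. eexists. apply is_derive_cdiff, Hd.
- split.
  + rewrite partial_section_ctrunc by assumption.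
    rewrite ctrunc_at_0. exact Ha0.
  + rewrite (C_derive_cdiff _ _ _ (Hd 0)), ctrunc_at_0. exact (proj1 (proj2 Hb)).
- exists 0, (fun w => w). split.
  + split; [|split; [|split]].
    * intros z _. eexists. apply is_derive_cdiff, cdiff_id.
    * split; [reflexivity | apply Did].
    * intros z _. rewrite Did. apply Cmod_gt_0. rewrite Cmod_1. lra.
    * intros z _. unfold curvature. rewrite Did, Dconst.
      replace (1 + z * 0 / 1)%C with (RtoC 1) by field. simpl. lra.
  + intros z Hz. rewrite Did, (C_derive_cdiff _ _ _ (Hd z)).
    replace (expi 0 * (ctrunc (cderiv_coef a) (S n) z / 1))%C
      with (ctrunc (cderiv_coef a) (S n) z).
    2:{ unfold expi. rewrite cos_0, sin_0. change (1, 0) with (RtoC 1). field. }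
    destruct Hroot as [Hrho _]. pose proof (Cmod_ge_0 z).
    apply (section_deriv_Re_gt alpha); try assumption; try lra.
    apply Hpos. split; assumption.
Qed.
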